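(* Let $X$ be a locally Nachbin ordered space (respectively, a strictly locally Nachbin ordered space) and let $\ast\in X$. In the category of locally Nachbin ordered spaces (respectively, of strictly locally Nachbin ordered spaces), there exists a coequalizer of $i_\ast,c_\ast:S^1\to\overrightarrow{S^1}\times X$ if, and only if, the family of clopen neighbourhoods of $\ast$ in $X$ has a smallest element (with respect to inclusion). If $O$ is such a smallest clopen neighbourhood, then $q_O:\overrightarrow{S^1}\times X\to X_O$ is the coequalizer.
   Context: **Locally ordered spaces.** For posets $B,B'$ write $B\subset_{lax}B'$ when $|B|\subset|B'|$ and $p\leq_B q$ implies $p\leq_{B'}q$ for all $p,q\in B$; write $B\subset_{str}B'$ when $|B|\subset |B'|$ and $\leq_B$ is the restriction of $\leq_{B'}$ to $B$. An *ordered basis* on a topological space $X$ is a set $\mathfrak B$ of posets whose underlying sets form a basis of the topology of $X$ and such that for all $x\in X$ and $B,B'\in\mathfrak B$ with $x\in B\cap B'$ there is $B''\in\mathfrak B$ with $x\in B''$, $B''\subset_{lax}B$ and $B''\subset_{lax}B'$. It is *strict* if one can always find such $B''$ with $B''\subset_{str}B$ and $B''\subset_{str}B'$. An ordered basis $\mathfrak B'$ is *coarser* than $\mathfrak B$ if for every $x\in X$ and every $B'\in\mathfrak B'$ with $x\in B'$ there is $B\in\mathfrak B$ with $x\in B\subset_{lax}B'$; two ordered bases are *equivalent* if each is coarser than the other. A *locally ordered space* is a topological space with an equivalence class of ordered bases; it is a *strictly* locally ordered space if the class contains a strict basis. Its *open posets* are the posets $A$ with $|A|\subset X$ such that for every $x\in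 A$ there is $B\in\mathfrak B$ with $x\in B\subset_{lax}A$ (for $\mathfrak B$ any basis in the class); they form the largest ordered basis of the class, denoted $\overrightarrow{\mathcal O}(X)$. **Nachbin.** A *Nachbin ordered space* is a topological space $P$ with a partial order that is closed in $P\times P$. A locally ordered space $X$ is *locally Nachbin ordered* if for all $x\in X$ and $O\in\overrightarrow{\mathcal O}(X)$ with $x\in O$ there is $O'\in\overrightarrow{\mathcal O}(X)$ with $x\in O'\subset_{lax}O$ that is a Nachbin ordered space for the topology inherited from $X$. A strictly locally Nachbin ordered space is a strictly locally ordered space that is locally Nachbin ordered. **Morphisms.** A map $f:X\to Y$ between locally ordered spaces with ordered bases $\mathfrak B,\mathfrak B'$ is *locally increasing at* $x$ if for all $B'\in\mathfrak B'$ with $f(x)\in B'$ there is $B\in\mathfrak B$ with $x\in B$, $f(B)\subset B'$ and $f:B\to B'$ increasing (independent of the bases in the classes). It is locally increasing if it is so at every point. These are the morphisms of all the categories considered. The product $X\times X'$ has ordered basis $\{B\times B'\}$ with product topology and product orders. **Circles.** $S^1=\{z\in\mathbb C:|z|=1\}$. A *proper open arc* is a set $\{e^{ix}: x\in{]a,b[}\}$ with $0<b-a<2\pi$; its standard order is $e^{ix}\leq e^{iy}$ iff $x\leq y$, for $x,y\in{]a,b[}$ (it depends only on the arc $\alpha$ and is written $\leq_\alpha$). The *directed circle* $\overrightarrow{S^1}$ has as ordered basis all proper open arcs with their standard orders. $S^1$, as a locally ordered space, is the *unordered circle*: proper open arcs ordered by equality. **The maps.** $i_\ast(s)=(s,\ast)$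 and $c_\ast(s)=(1,\ast)$. **The space $X_O$.** For an open neighbourhood $O$ of $\ast$, let $X_O=O\sqcup (S^1\times(X\setminus O))$ and $q_O:\overrightarrow{S^1}\times X\to X_O$, $q_O(s,t)=t$ if $t\in O$, $q_O(s,t)=(s,t)$ if $t\notin O$. $X_O$ carries the final topology of $q_O$. For a proper open arc $\alpha$ and $A\in\overrightarrow{\mathcal O}(X)$ let $U_{\alpha,A}=q_O(\alpha\times A)=(O\cap A)\sqcup(\alpha\times(A\setminus O))$, ordered by $\leq_{\alpha,A}$, the transitive closure of the image of the product order on $\alpha\times A$ under $q_O$. The posets $(U_{\alpha,A},\leq_{\alpha,A})$ form the ordered basis that makes $X_O$ a locally ordered space. *)

(* Defs.v *)
From HB Require Import structures.
From mathcomp Require Import all_boot all_order all_algebra complex.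
From mathcomp Require Import all_classical all_reals.
From mathcomp Require Import topology normedtype trigo.
From mathcomp Require Import ring lra.
From Stdlib Require Import Relation_Definitions Relation_Operators.
Set Implicit Arguments. Unset Strict Implicit. Unset Printing Implicit Defensive.
Import Order.TTheory GRing.Theory Num.Theory numFieldNormedType.Exports.
Local Open Scope classical_set_scope.
Local Open Scope ring_scope.
Local Open Scope complex_scope.

Local Obligation Tactic := idtac.

(* A poset on a subset of T; the order relation is supported on the carrier. *)
Record poset (T : Type) := Poset {
  pcar :> T -> Prop;
  ple : T -> T -> Prop;
  ple_pcar : forall x y, ple x y -> pcar x /\ pcar y;
  ple_refl : forall x, pcar x -> ple x x;
  ple_anti : forall x y, ple x y -> ple y x -> x = y;
  ple_trans : forall y x z, ple x y -> ple y z -> ple x z }.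

Definition lax_sub (T : Type) (B B' : poset T) :=
  B `<=` B' /\ forall p q, B p -> B q -> ple B p q -> ple B' p q.

Definition str_sub (T : Type) (B B' : poset T) :=
  B `<=` B' /\ forall p q, B p -> B q -> (ple B p q <-> ple B' p q).

Section OrderedBases.
Variable T : topologicalType.
Implicit Types F : set (poset T).

Definition ordered_basis F :=
  basis [set pcar B | B in F] /\
  forall x B B', F B -> F B' -> B x -> B' x ->
    exists B'', [/\ F B'', B'' x, lax_sub B'' B & lax_sub B'' B'].

Definition strict_ordered_basis F :=
  ordered_basis F /\
  forall x B B', F B -> F B' -> B x -> B' x ->
    exists B'', [/\ F B'', B'' x, str_sub B'' B & str_sub B'' B'].

Definition coarser F' F :=
  forall x B', F' B' -> B' x -> exists B, [/\ F B, B x & lax_sub B B'].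

Definition equivalent F F' := coarser F F' /\ coarser F' F.

End OrderedBases.

(* [lo_class] is an equivalence class of ordered bases. *)
Record lospace := LOSpace {
  lo_top :> topologicalType;
  lo_class : set (set (poset lo_top));
  lo_classP : exists2 F, ordered_basis F &
    lo_class = [set F' | ordered_basis F' /\ equivalent F F'] }.

Arguments lo_class : clear implicits.

Section PosetTheory.
Variable T : Type.
Implicit Types A B C : poset T.

Lemma lax_refl B : lax_sub B B. Proof. by split. Qed.

Lemma lax_trans B A C : lax_sub A B -> lax_sub B C -> lax_sub A C.
Proof.
move=> [AB oAB] [BC oBC]; split; first exact: subset_trans BC.
by move=> p q Ap Aq /(oAB _ _ Ap Aq)/oBC; apply; exact: AB.
Qed.

Lemma lax_le A B p q : lax_sub A B -> ple A p q -> ple B p q.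
Proof. by move=> [_ oAB] Apq; have [? ?] := ple_pcar Apq; apply: oAB. Qed.

Lemma str_lax A B : str_sub A B -> lax_sub A B.
Proof. by move=> [AB oAB]; split=> // p q Ap Aq /oAB; apply. Qed.

Program Definition restrict (A : poset T) (V : set T) : poset T :=
  @Poset T (A `&` V) (fun x y => [/\ V x, V y & ple A x y]) _ _ _ _.
Next Obligation. by move=> A V x y [Vx Vy xy]; have [? ?] := ple_pcar xy. Qed.
Next Obligation. by move=> A V x [Ax Vx]; split=> //; exact: ple_refl. Qed.
Next Obligation. by move=> A V x y [_ _ xy] [_ _]; exact: ple_anti. Qed.
Next Obligation.
by move=> A V y x z [? ? xy] [? ? yz]; split=> //; exact: ple_trans yz.
Qed.

Lemma lax_restrict A V : lax_sub (restrict A V) A.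
Proof. by split=> [p []|p q _ _ []]. Qed.

Program Definition discrete_poset (V : set T) : poset T :=
  @Poset T V (fun x y => V x /\ x = y) _ _ _ _.
Next Obligation. by move=> V x y [Vx <-]. Qed.
Next Obligation. by []. Qed.
Next Obligation. by move=> V x y []. Qed.
Next Obligation. by move=> V y x z [Vx ->]. Qed.

End PosetTheory.

Program Definition prod_poset (S T : Type) (A : poset S) (B : poset T) : poset (S * T) :=
  @Poset (S * T) (A `*` B) (fun p q => ple A p.1 q.1 /\ ple B p.2 q.2) _ _ _ _.
Next Obligation.
move=> S T A B p q [pq1 pq2].
by have [? ?] := ple_pcar pq1; have [? ?] := ple_pcar pq2.
Qed.
Next Obligation. by move=> S T A B p [? ?]; split; exact: ple_refl. Qed.
Next Obligation.
move=> S T A B [p p'] [q q'] /= [pq pq'] [qp qp'].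
by rewrite (ple_anti pq qp) (ple_anti pq' qp').
Qed.
Next Obligation.
move=> S T A B q p r [pq pq'] [qr qr'].
by split; [exact: ple_trans qr|exact: ple_trans qr'].
Qed.

Section BasisTheory.
Variable T : topologicalType.
Implicit Types F G : set (poset T).

Lemma coarser_refl F : coarser F F.
Proof. by move=> x B FB Bx; exists B; split=> //; exact: lax_refl. Qed.

Lemma coarser_trans G F F' : coarser F G -> coarser G F' -> coarser F F'.
Proof.
move=> FG GF' x B /FG /[apply] -[C [GC Cx CB]].
have [D [FD Dx DC]] := GF' _ _ GC Cx.
by exists D; split=> //; exact: lax_trans CB.
Qed.

Lemma basis_open F B : ordered_basis F -> F B -> open (pcar B).
Proof. by move=> [[Fo _] _] FB; apply: Fo; exists B. Qed.

Lemma basis_nbhs F x V : ordered_basis F -> nbhs x V ->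
  exists B, [/\ F B, B x & B `<=` V].
Proof.
by move=> [[_ Fn] _] /Fn[_ [[B FB <-] Bx] BV]; exists B.
Qed.

Lemma ordered_basisP F :
  (forall B, F B -> open (pcar B)) ->
  (forall x V, nbhs x V -> exists B, [/\ F B, B x & B `<=` V]) ->
  (forall x B B', F B -> F B' -> B x -> B' x ->
    exists B'', [/\ F B'', B'' x, lax_sub B'' B & lax_sub B'' B']) ->
  ordered_basis F.
Proof.
move=> Fo Fn FI; split=> //; split=> [_ [B FB <-]|x V /Fn[B [FB Bx BV]]].
  exact: Fo.
by exists B => //; split=> //; exists B.
Qed.

End BasisTheory.

Definition lospace_of_basis (T : topologicalType) (F : set (poset T))
  (Fb : ordered_basis F) : lospace :=
  LOSpace (ex_intro2 _ (fun F0 => [set F' | ordered_basis F' /\ equivalent F F']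
    = [set F' | ordered_basis F' /\ equivalent F0 F']) F Fb erefl).

Section LOTheory.
Variable X : lospace.

Lemma lo_class_basis F : lo_class X F -> ordered_basis F.
Proof. by have [F0 _ ->] := lo_classP X => -[]. Qed.

Lemma lo_class_equiv F F' : lo_class X F -> lo_class X F' -> equivalent F F'.
Proof.
have [F0 _ ->] := lo_classP X => -[_ [h1 h2]] [_ [h1' h2']].
by split; [exact: coarser_trans h1'|exact: coarser_trans h1].
Qed.

Lemma lo_class_neq0 : exists F, lo_class X F.
Proof.
have [F0 F0b ->] := lo_classP X; exists F0.
by do 2!split=> //; exact: coarser_refl.
Qed.

Definition lo_basis : set (poset X) := sval (cid lo_class_neq0).

Lemma lo_basisP : lo_class X lo_basis.
Proof. exact: svalP (cid lo_class_neq0). Qed.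

Definition open_poset : set (poset X) :=
  [set A : poset X | forall F, lo_class X F -> forall x, A x ->
    exists B, [/\ F B, B x & lax_sub B A]].

Lemma open_posetP F (A : poset X) : lo_class X F ->
  (forall x, A x -> exists B, [/\ F B, B x & lax_sub B A]) <-> open_poset A.
Proof.
move=> XF; split=> [h F' XF' x Ax|]; last exact.
have [B [FB Bx BA]] := h _ Ax.
have [C [F'C Cx CB]] := (lo_class_equiv XF XF').1 _ _ FB Bx.
by exists C; split=> //; exact: lax_trans BA.
Qed.

Lemma class_open_poset F (B : poset X) : lo_class X F -> F B -> open_poset B.
Proof. by move=> XF FB; apply/(open_posetP _ XF) => x Bx; exact: coarser_refl Bx. Qed.

Lemma open_poset_open (A : poset X) : open_poset A -> open (pcar A).
Proof.
have [F XF] := lo_class_neq0; have Fb := lo_class_basis XF => oA.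
rewrite openE => x /(oA _ XF)[B [FB Bx [BA _]]].
by apply: (filterS BA); apply: open_nbhs_nbhs; split=> //; exact: basis_open FB.
Qed.

Lemma open_poset_nbhs (x : X) (V : set X) : nbhs x V ->
  exists B, [/\ open_poset B, B x & B `<=` V].
Proof.
have [F XF] := lo_class_neq0 => /(basis_nbhs (lo_class_basis XF))[B [FB Bx BV]].
by exists B; split=> //; exact: class_open_poset FB.
Qed.

Lemma open_posetI x (A A' : poset X) : open_poset A -> open_poset A' -> A x -> A' x ->
  exists A'', [/\ open_poset A'', A'' x, lax_sub A'' A & lax_sub A'' A'].
Proof.
have [F XF] := lo_class_neq0; have Fb := lo_class_basis XF.
move=> oA oA' /(oA _ XF)[B [FB Bx BA]] /(oA' _ XF)[B' [FB' Bx' BA']].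
have [C [FC Cx CB CB']] := Fb.2 _ _ _ FB FB' Bx Bx'.
exists C; split=> //; first exact: class_open_poset FC.
  exact: lax_trans BA.
exact: lax_trans BA'.
Qed.

Lemma open_poset_basis : ordered_basis open_poset.
Proof.
apply: ordered_basisP; [exact: open_poset_open|exact: open_poset_nbhs|].
exact: open_posetI.
Qed.

Lemma open_poset_class : lo_class X open_poset.
Proof.
have [F XF] := lo_class_neq0; have [F0 F0b eF0] := lo_classP X.
move: (XF); rewrite eF0 => -[Fb [h1 h2]]; split; first exact: open_poset_basis.
split=> x B.
  by move=> /h1 /[apply] -[C [FC Cx CB]]; exists C;
  split=> //; exact: class_open_poset FC.
move=> oB /(oB _ XF)[C [FC Cx CB]]; have [D [F0D Dx DC]] := h2 _ _ FC Cx.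
by exists D; split=> //; exact: lax_trans CB.
Qed.

Lemma open_poset_restrict (A : poset X) (V : set X) :
  open_poset A -> open V -> open_poset (restrict A V).
Proof.
have [F XF] := lo_class_neq0; have Fb := lo_class_basis XF.
move=> oA oV; apply/(open_posetP _ XF) => x [/(oA _ XF)[B [FB Bx BA]] Vx].
have [C [FC Cx CV]] := basis_nbhs Fb (open_nbhs_nbhs (conj oV Vx)).
have [D [FD Dx DB DC]] := Fb.2 _ _ _ FB FC Bx Cx.
exists D; split=> //; have [DA lDA] := lax_trans DB BA.
have DV := subset_trans DC.1 CV.
by split=> [y Dy|y z Dy Dz yz]; split; [exact: DA|exact: DV|exact: DV|exact: DV|exact: lDA].
Qed.

End LOTheory.

Arguments lo_basis : clear implicits.
Arguments open_poset : clear implicits.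

Definition strictly_locally_ordered (X : lospace) :=
  exists2 F, lo_class X F & strict_ordered_basis F.

Definition nachbin_ordered (P : topologicalType) (le : P -> P -> Prop) :=
  Relation_Definitions.order P le /\ closed [set p : P * P | le p.1 p.2].

Definition locally_nachbin (X : lospace) :=
  forall x (O : poset X), open_poset X O -> O x ->
    exists O' : poset X, [/\ open_poset X O', O' x, lax_sub O' O &
      @nachbin_ordered (set_type O') (fun a b => ple O' (val a) (val b))].

Definition strictly_locally_nachbin (X : lospace) :=
  strictly_locally_ordered X /\ locally_nachbin X.

Section Morphisms.
Variables X Y : lospace.

Definition locally_increasing_at (f : X -> Y) (x : X) :=
  forall (F : set (poset X)) (F' : set (poset Y)), lo_class X F -> lo_class Y F' ->
    forall B', F' B' -> B' (f x) ->
      exists B, [/\ F B, B x, f @` B `<=` B' &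
        forall p q, B p -> B q -> ple B p q -> ple B' (f p) (f q)].

Definition locally_increasing (f : X -> Y) := forall x, locally_increasing_at f x.

Lemma locally_increasing_atP F F' f x : lo_class X F -> lo_class Y F' ->
  (forall B', F' B' -> B' (f x) ->
    exists B, [/\ F B, B x, f @` B `<=` B' &
      forall p q, B p -> B q -> ple B p q -> ple B' (f p) (f q)]) <->
  locally_increasing_at f x.
Proof.
move=> XF YF'; split=> [h G G' XG YG' C' G'C' C'fx|]; last exact.
have [B' [F'B' B'fx B'C']] := (lo_class_equiv YG' YF').1 _ _ G'C' C'fx.
have [B [FB Bx fBB' leBB']] := h _ F'B' B'fx.
have [C [GC Cx CB]] := (lo_class_equiv XF XG).1 _ _ FB Bx.
exists C; split=> //.
  by move=> _ [y Cy <-]; apply: B'C'.1; apply: fBB'; exists y => //; exact: CB.1.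
move=> p q Cp Cq pq; apply: (lax_le B'C'); apply: leBB'; [exact: CB.1|exact: CB.1|].
exact: lax_le pq.
Qed.

Record lomap := LOMap { lofun :> X -> Y; lofunP : locally_increasing lofun }.

End Morphisms.

Lemma lo_class_of_basis (T : topologicalType) (F : set (poset T))
  (Fb : ordered_basis F) : lo_class (lospace_of_basis Fb) F.
Proof. by do 2!split=> //; exact: coarser_refl. Qed.

(* q is a coequalizer of f and g in the full subcategory of the locally ordered
   spaces that satisfy C, to which S, T and Q are therefore required to belong. *)
Record is_coequalizer (C : lospace -> Prop) (S T Q : lospace)
    (f g : lomap S T) (q : lomap T Q) : Prop := IsCoequalizer {
  coeq_source : C S;
  coeq_target : C T;
  coeq_object : C Q;
  coeq_eq : q \o f =1 q \o g;
  coeq_univ : forall (Z : lospace) (u : lomap T Z), C Z -> u \o f =1 u \o g ->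
    exists! h : lomap Q Z, h \o q =1 u }.

Section Product.
Variables X Y : topologicalType.

Definition prod_basis (F : set (poset X)) (F' : set (poset Y)) :
    set (poset (X * Y)) :=
  [set prod_poset B B' | B in F & B' in F'].

Lemma prod_basisP F F' : ordered_basis F -> ordered_basis F' ->
  ordered_basis (prod_basis F F').
Proof.
move=> Fb Fb'; apply: ordered_basisP.
- move=> _ [B FB [B' FB' <-]]; rewrite openE => -[x y] [/= Bx By].
  exists (B : set X, B' : set Y) => //; split=> /=; apply: open_nbhs_nbhs.
    by split=> //; exact: basis_open Fb FB.
  by split=> //; exact: basis_open Fb' FB'.
- move=> [x y] V [[U U'] /= [Ux Uy] UV].
  have [B [FB Bx BU]] := basis_nbhs Fb Ux.
  have [B' [FB' By BU']] := basis_nbhs Fb' Uy.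
  exists (prod_poset B B'); split=> //; first by exists B => //; exists B'.
  by move=> [p q] [/BU Up /BU' Uq]; exact: UV.
- move=> [x y] _ _ [B FB [B' FB' <-]] [C FC [C' FC' <-]] [/= Bx By] [/= Cx Cy].
  have [D [FD Dx DB DC]] := Fb.2 _ _ _ FB FC Bx Cx.
  have [D' [FD' Dy DB' DC']] := Fb'.2 _ _ _ FB' FC' By Cy.
  exists (prod_poset D D'); split=> //; first by exists D => //; exists D'.
  + split=> [[p q] [/DB.1 Bp /DB'.1 Bq] //|[p q] [p' q'] _ _ [/= pp qq]].
    by split=> /=; [exact: lax_le pp|exact: lax_le qq].
  + split=> [[p q] [/DC.1 Bp /DC'.1 Bq] //|[p q] [p' q'] _ _ [/= pp qq]].
    by split=> /=; [exact: lax_le pp|exact: lax_le qq].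
Qed.

End Product.

(* The class does not depend on the bases chosen for the factors. *)
Definition lo_prod (X Y : lospace) : lospace :=
  lospace_of_basis
    (prod_basisP (lo_class_basis (lo_basisP X)) (lo_class_basis (lo_basisP Y))).

Lemma lo_class_prod (X Y : lospace) F F' : lo_class X F -> lo_class Y F' ->
  lo_class (lo_prod X Y) (prod_basis F F').
Proof.
move=> XF YF'; split.
  exact: (prod_basisP (lo_class_basis XF) (lo_class_basis YF')).
have [XFX XXF] := lo_class_equiv XF (lo_basisP X).
have [YFY YYF] := lo_class_equiv YF' (lo_basisP Y).
split=> -[x y] _ [B FB [B' FB' <-]] [/= Bx By].
- have [C [FC Cx CB]] := XXF _ _ FB Bx.
  have [C' [FC' Cy CB']] := YYF _ _ FB' By.
  exists (prod_poset C C'); split=> //; first by exists C => //; exists C'.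
  split=> [[p q] [/CB.1 Bp /CB'.1 Bq] //|[p q] [p' q'] _ _ [/= pp qq]].
  by split=> /=; [exact: lax_le pp|exact: lax_le qq].
- have [C [FC Cx CB]] := XFX _ _ FB Bx.
  have [C' [FC' Cy CB']] := YFY _ _ FB' By.
  exists (prod_poset C C'); split=> //; first by exists C => //; exists C'.
  split=> [[p q] [/CB.1 Bp /CB'.1 Bq] //|[p q] [p' q'] _ _ [/= pp qq]].
  by split=> /=; [exact: lax_le pp|exact: lax_le qq].
Qed.

Definition S1 (R : realType) : set R[i]^o := [set z | `|z| = 1].

Arguments S1 R : clear implicits.

Section Circle.
Variable R : realType.

Lemma cis_subproof (x : R) : (cos x +i* sin x : R[i]^o) \in S1 R.
Proof. by rewrite inE /S1 /= normc_def /= cos2Dsin2 sqrtr1. Qed.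

(* e^{ix} *)
Definition cis (x : R) : S1 R := exist _ (cos x +i* sin x : R[i]^o) (cis_subproof x).

Lemma cis_cos (x y : R) : cis x = cis y -> cos (x - y) = 1.
Proof. by move=> [ec es]; rewrite cosB ec es -!expr2 cos2Dsin2. Qed.

Lemma cos_half (d : R) : cos d = 1 - (sin (d / 2)) ^+ 2 *+ 2.
Proof.
have {1}-> : d = (d / 2) *+ 2 by rewrite -mulr_natr divfK ?pnatr_eq0.
rewrite cos_mulr2n cos2sin2; ring.
Qed.

Lemma cos1_eq0 (d : R) : `|d| < pi *+ 2 -> cos d = 1 -> d = 0.
Proof.
move=> dpi; rewrite -(cos_norm d) => c1.
have [->//|d0] := eqVneq d 0; have n0 : 0 < `|d| by rewrite normr_gt0.
have : 0 < sin (`|d| / 2) by apply: sin_gt0_pi; apply/andP; split; lra.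
move: c1; rewrite cos_half => h s0; nra.
Qed.

Lemma cis_inj (x y : R) : `|x - y| < pi *+ 2 -> cis x = cis y -> x = y.
Proof. by move=> h /cis_cos/(cos1_eq0 h); lra. Qed.

Lemma cis_surj (z : S1 R) : exists x, z = cis x.
Proof.
case: z => -[a b] abP; have := abP; rewrite inE /S1 /= normc_def /= => -[h].
have ab : a ^+ 2 + b ^+ 2 = 1.
  have p : 0 <= a ^+ 2 + b ^+ 2 by rewrite addr_ge0 ?sqr_ge0.
  by rewrite -(sqr_sqrtr p) h expr1n.
have a1 : -1 <= a <= 1 by apply/andP; split; nra.
have ca : cos (acos a) = a by rewrite acosK // in_itv /=.
have sa : sin (acos a) = `|b|.
  rewrite sin_acos //; have -> : 1 - a ^+ 2 = b ^+ 2 by lra.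
  by rewrite sqrtr_sqr.
have [b0|b0] := leP 0 b.
  exists (acos a); apply/val_inj; rewrite /= ca sa ger0_norm //.
exists (- acos a); apply/val_inj; rewrite /= cosN sinN ca sa ltr0_norm // opprK //.
Qed.

Lemma cis_shift (x x' y : R) : cis x = cis x' -> cis (y + (x' - x)) = cis y.
Proof.
move=> /esym [ec es]; apply/val_inj => /=.
have c1 : cos (x' - x) = 1 by rewrite cosB ec es -!expr2 cos2Dsin2.
have s0 : sin (x' - x) = 0 by rewrite sinB ec es; ring.
by rewrite (cosD y) (sinD y) c1 s0 !mulr0 !mulr1 subr0 addr0.
Qed.

Lemma continuous_cis : continuous cis.
Proof.
apply: continuous_comp_initial => x.
apply/cvgrPdist_lt => e; rewrite ltcE /= => /andP[/eqP ie re].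
have e2 : 0 < complex.Re e / 2 by rewrite divr_gt0.
have /cvgrPdist_lt/(_ _ e2) hc := @continuous_cos R x.
have /cvgrPdist_lt/(_ _ e2) hs := @continuous_sin R x.
near=> y.
have hcy : `|cos x - cos y| < complex.Re e / 2 by near: y.
have hsy : `|sin x - sin y| < complex.Re e / 2 by near: y.
rewrite normc_def /= ltcE /= ie eqxx /=.
set u := _ - _ in hcy *; set v := _ - _ in hsy *.
have -> : complex.Re e = Num.sqrt ((complex.Re e) ^+ 2) by rewrite sqrtr_sqr gtr0_norm.
rewrite ltr_sqrt ?exprn_gt0 //.
have -> : u ^+ 2 = `|u| ^+ 2 by rewrite real_normK ?num_real.
have -> : v ^+ 2 = `|v| ^+ 2 by rewrite real_normK ?num_real.
have := normr_ge0 u; have := normr_ge0 v; nra.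
Unshelve. all: by end_near. Qed.

Lemma continuous_ReIm :
  continuous (fun w : R[i]^o => complex.Re w : R) /\
  continuous (fun w : R[i]^o => complex.Im w : R).
Proof.
split=> z A /nbhs_ballP[e /= e0 eA]; apply/nbhs_ballP;
  (exists (e%:C); first by rewrite /= ltcR); move=> w wz; apply: eA;
  move: wz; rewrite -!ball_normE /= normc_def /= ltcR; case: z w => [a b] [c d] /=;
  apply: le_lt_trans; rewrite -[leLHS]sqrtr_sqr; apply: ler_wsqrtr;
  by rewrite ?lerDl ?lerDr sqr_ge0.
Qed.

Definition arc_set (a b : R) : set (S1 R) := cis @` `]a, b[.

Lemma arc_setE (m d : R) : 0 < d -> d < pi ->
  arc_set (m - d) (m + d) =
  [set z | cos d < complex.Re (val z) * cos m + complex.Im (val z) * sin m].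
Proof.
move=> d0 dpi; apply/seteqP; split => [_ [x /= xab <-]|z] /=.
  rewrite -cosB -(cos_norm (x - m)) ltr_cos ?in_itv /= ?normr_ge0 ?(ltW d0) ?(ltW dpi) //.
  - by move: xab; rewrite in_itv /= => /andP[? ?]; rewrite ltr_norml; apply/andP; split; lra.
  - by move: xab; rewrite in_itv /= => /andP[? ?]; rewrite ler_norml; apply/andP; split; lra.
have [x ->] := cis_surj z; rewrite /= -cosB => h.
set c := cos (x - m) in h.
have c1 : -1 <= c <= 1 by rewrite cos_geN1 cos_le1.
have ad : acos c < d.
  rewrite -ltr_cos ?in_itv /= ?acos_ge0 ?acos_lepi ?(ltW d0) ?(ltW dpi) //.
  by rewrite acosK // in_itv.
have a0 := acos_ge0 c1.
have ca : cos (acos c) = cos (x - m) by rewrite acosK // in_itv.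
have sa : (sin (acos c)) ^+ 2 = (sin (x - m)) ^+ 2 by rewrite !sin2cos2 ca.
have [s|s] : sin (acos c) = sin (x - m) \/ sin (- acos c) = sin (x - m).
  move/eqP: sa; rewrite sinN eqf_sqr => /orP[/eqP ->|/eqP ->]; first by left.
  by right; rewrite opprK.
- exists (m + acos c); first by rewrite /= in_itv /=; apply/andP; split; lra.
  have -> : x = m + (x - m) by rewrite addrC subrK.
  by apply/val_inj; rewrite /= !(cosD m) !(sinD m) ca s.
- exists (m - acos c); first by rewrite /= in_itv /=; apply/andP; split; lra.
  have -> : x = m + (x - m) by rewrite addrC subrK.
  by apply/val_inj; rewrite /= !(cosD m) !(sinD m) cosN ca s.
Qed.

Lemma open_arc_set (a b : R) : 0 < b - a < pi *+ 2 -> open (arc_set a b).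
Proof.
move=> /andP[ab0 ab2].
have -> : a = (a + b) / 2 - (b - a) / 2 by lra.
have {3}-> : b = (a + b) / 2 + (b - a) / 2 by lra.
rewrite arc_setE; [|lra|lra].
set m := (a + b) / 2; set d := (b - a) / 2.
have [cR cI] := continuous_ReIm.
rewrite (_ : [set z | _] = (fun z : S1 R => complex.Re (val z) * cos m
   + complex.Im (val z) * sin m) @^-1` [set y | cos d < y]) //.
apply: open_comp; last exact: open_gt.
have cv : continuous (fun z : S1 R => (val z : R[i]^o)) by exact: initial_continuous.
have cvR : continuous (fun z : S1 R => complex.Re (val z) : R).
  by move=> z; apply: (continuous_comp (cv z)); exact: cR.
have cvI : continuous (fun z : S1 R => complex.Im (val z) : R).
  by move=> z; apply: (continuous_comp (cv z)); exact: cI.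
by move=> z _; exact: (cvgD (cvgM (cvR z) (cvg_cst (cos m))) (cvgM (cvI z) (cvg_cst (sin m)))).
Qed.


Lemma arc_set_nbhs (x : R) (V : set (S1 R)) : nbhs (cis x) V ->
  exists2 e, 0 < e < pi & arc_set (x - e) (x + e) `<=` V.
Proof.
move=> /continuous_cis; rewrite nbhs_simpl /= => /nbhs_ballP[e /= e0 eV].
have p0 := pi_gt0 R.
exists (Num.min e (pi / 2)).
  by rewrite lt_min e0 gt_min /=; apply/andP; split; [lra|apply/orP; right; lra].
move=> _ [y /= yx <-]; apply: eV; rewrite -ball_normE /=.
move: yx; rewrite in_itv /= => /andP[y1 y2].
have : Num.min e (pi / 2) <= e by rewrite ge_min lexx.
by rewrite ltr_norml => ?; apply/andP; split; lra.
Qed.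

(* the order e^{ix} <= e^{iy} iff x <= y, for x, y in ]a, b[ *)
Program Definition arc (a b : R) (ab : 0 < b - a < pi *+ 2) : poset (S1 R) :=
  @Poset (S1 R) (arc_set a b)
    (fun z w => exists x y, [/\ x \in `]a, b[, y \in `]a, b[, x <= y,
                                z = cis x & w = cis y]) _ _ _ _.
Next Obligation.
by move=> a b _ _ _ [x [y [xab yab _ -> ->]]]; split; [exists x|exists y].
Qed.
Next Obligation.
by move=> a b _ _ [x xab <-]; exists x, x; split.
Qed.
Next Obligation.
move=> a b /andP[ab0 abpi] _ _ [x [y [xab yab xy -> ->]]] [y' [x' [yab' xab' yx ey ex]]].
have inj u v : u \in `]a, b[ -> v \in `]a, b[ -> cis u = cis v -> u = v.
  rewrite !in_itv /= => /andP[? ?] /andP[? ?]; apply: cis_inj.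
  by rewrite ltr_norml; apply/andP; split; lra.
move: (inj _ _ yab yab' ey) (inj _ _ xab xab' ex) yx => <- <- yx.
by congr cis; apply/eqP; rewrite eq_le xy.
Qed.
Next Obligation.
move=> a b /andP[ab0 abpi] _ _ _ [x [y [xab yab xy -> ->]]] [y' [z [yab' zab yz ey ->]]].
have inj u v : u \in `]a, b[ -> v \in `]a, b[ -> cis u = cis v -> u = v.
  rewrite !in_itv /= => /andP[? ?] /andP[? ?]; apply: cis_inj.
  by rewrite ltr_norml; apply/andP; split; lra.
exists x, z; split=> //.
by move: (inj _ _ yab yab' ey) yz => <-; exact: le_trans.
Qed.

Definition arcs : set (poset (S1 R)) :=
  [set A | exists a b (ab : 0 < b - a < pi *+ 2), A = arc ab].

Lemma arcs_neq0 (A : poset (S1 R)) : arcs A -> exists z, A z.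
Proof.
move=> [a [b [ab ->]]]; exists (cis ((a + b) / 2)); exists ((a + b) / 2) => //.
by case/andP: ab => ? ?; rewrite /= in_itv /=; apply/andP; split; lra.
Qed.

Lemma arcs_open (A : poset (S1 R)) : arcs A -> open (pcar A).
Proof. by move=> [a [b [ab ->]]]; exact: open_arc_set. Qed.

Lemma arcs_nbhs (z : S1 R) (V : set (S1 R)) : nbhs z V ->
  exists A, [/\ arcs A, A z & A `<=` V].
Proof.
have [x ->] := cis_surj z => /arc_set_nbhs[e /andP[e0 epi] eV].
have h : 0 < (x + e) - (x - e) < pi *+ 2 by apply/andP; split; lra.
exists (arc h); split=> //; first by exists (x - e), (x + e), h.
by exists x => //; rewrite /= in_itv /=; apply/andP; split; lra.
Qed.

Lemma arcsI (z : S1 R) (A A' : poset (S1 R)) :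
  arcs A -> arcs A' -> A z -> A' z ->
  exists A'', [/\ arcs A'', A'' z, lax_sub A'' A & lax_sub A'' A'].
Proof.
move=> [a [b [ab ->]]] [a' [b' [ab' ->]]] [x /= xab <-] [x' /= xab' exx'].
have /andP[? ?] := ab; have /andP[? ?] := ab'.
have : (a < x < b) /\ (a' < x' < b') by move: xab xab'; rewrite !in_itv.
move=> [/andP[? ?] /andP[? ?]].
pose e := Num.min (Num.min (x - a) (b - x)) (Num.min (x' - a') (b' - x')).
have e0 : 0 < e by rewrite !lt_min -!andbA; apply/and4P; split; lra.
have [e1 e2 e3 e4] : [/\ e <= x - a, e <= b - x, e <= x' - a' & e <= b' - x'].
  by split; rewrite !ge_min lexx ?orbT.
have h : 0 < (x + e) - (x - e) < pi *+ 2 by apply/andP; split; lra.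
have sub u : u \in `]x - e, x + e[ ->
    (u \in `]a, b[) /\ (u + (x' - x) \in `]a', b'[).
  by rewrite !in_itv /= => /andP[? ?]; split; apply/andP; split; lra.
have sh u : cis u = cis (u + (x' - x)) by rewrite (@cis_shift x x').
exists (arc h); split.
- by exists (x - e), (x + e), h.
- by exists x => //; rewrite /= in_itv /=; apply/andP; split; lra.
- split=> [_ [u /sub[uab _] <-]|_ _ _ _ [u [v [/sub[uab _] /sub[vab _] uv -> ->]]]].
    by exists u.
  by exists u, v.
- split=> [_ [u /sub[_ uab] <-]|_ _ _ _ [u [v [/sub[_ uab] /sub[_ vab] uv -> ->]]]].
    by rewrite sh; exists (u + (x' - x)).
  rewrite (sh u) (sh v); exists (u + (x' - x)), (v + (x' - x)).
  by split=> //; lra.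
Qed.

Lemma arcs_basis : ordered_basis arcs.
Proof. exact: (ordered_basisP arcs_open arcs_nbhs arcsI). Qed.

Definition discrete_arcs : set (poset (S1 R)) := [set discrete_poset A | A in arcs].

Lemma discrete_arcs_basis : ordered_basis discrete_arcs.
Proof.
apply: ordered_basisP; [move=> _ [A arcA <-]|move=> z V /arcs_nbhs[A [arcA Az AV]]|].
- exact: (arcs_open arcA).
- by exists (discrete_poset A); split=> //; exists A.
- move=> z _ _ [A arcA <-] [B arcB <-] /= Az Bz.
  have [D [arcD Dz [DA _] [DB _]]] := arcsI arcA arcB Az Bz.
  exists (discrete_poset D); split=> //; first by exists D.
  + by split=> // p q _ _ [Dp <-]; split=> //; exact: DA.
  + by split=> // p q _ _ [Dp <-]; split=> //; exact: DB.
Qed.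

Definition unordered_circle : lospace := lospace_of_basis discrete_arcs_basis.

Definition directed_circle : lospace := lospace_of_basis arcs_basis.

End Circle.

Arguments arcs R : clear implicits.
Arguments discrete_arcs R : clear implicits.

Section CircleMaps.
Variables (R : realType) (X : lospace) (pt : X).

Local Notation target := (lo_prod (directed_circle R) X).

Lemma S1_one_subproof : (1 : R[i]^o) \in S1 R.
Proof. by rewrite inE /S1 /= normr1. Qed.

Definition S1_one : S1 R := exist _ (1 : R[i]^o) S1_one_subproof.

Lemma base_circle_subproof :
  @locally_increasing (unordered_circle R) target (fun s => (s, pt)).
Proof.
move=> s; apply/(@locally_increasing_atP (unordered_circle R) target
  (discrete_arcs R) (prod_basis (arcs R) (lo_basis X))).
- exact: lo_class_of_basis.
- exact: (lo_class_prod (lo_class_of_basis (@arcs_basis R)) (lo_basisP X)).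
- move=> _ [A arcA [B XB <-]] [/= As Bpt].
  exists (discrete_poset A); split=> //; first by exists A.
    by move=> _ [z /= Az <-].
  by move=> z _ Az _ [_ <-]; split; exact: ple_refl.
Qed.

Definition base_circle : lomap (unordered_circle R) target :=
  @LOMap (unordered_circle R) target (fun s => (s, pt)) base_circle_subproof.

Lemma base_const_subproof :
  @locally_increasing (unordered_circle R) target (fun=> (S1_one, pt)).
Proof.
move=> s; apply/(@locally_increasing_atP (unordered_circle R) target
  (discrete_arcs R) (prod_basis (arcs R) (lo_basis X))).
- exact: lo_class_of_basis.
- exact: (lo_class_prod (lo_class_of_basis (@arcs_basis R)) (lo_basisP X)).
- move=> B' _ B'1.
  have [A [arcA As _]] := arcs_nbhs (@filterT _ _ (nbhs_filter s)).
  exists (discrete_poset A); split=> //; first by exists A.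
    by move=> _ [z /= Az <-].
  by move=> z z' _ _ _; exact: ple_refl.
Qed.

Definition base_const : lomap (unordered_circle R) target :=
  @LOMap (unordered_circle R) target (fun=> (S1_one, pt)) base_const_subproof.

End CircleMaps.

Section Collapse.
Variable R : realType.

Section CollapseSpace.
Variables (T : topologicalType) (O : set T).

(* S^1 x T with each circle S^1 x {t}, t in O, collapsed to the point t *)
Definition collapse : Type := (set_type O + S1 R * set_type (~` O))%type.

HB.instance Definition _ :=
  Choice.copy collapse (set_type O + S1 R * set_type (~` O))%type.

Definition collapse_fun (p : S1 R * T) : collapse :=
  match pselect (O p.2) with
  | left Op => inl (exist _ p.2 (mem_set Op))
  | right nOp => inr (p.1, exist _ p.2 (mem_set nOp))
  end.

Definition collapse_open : set (set collapse) :=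
  [set V | open (collapse_fun @^-1` V)].

Lemma collapse_openT : collapse_open setT.
Proof. by rewrite /collapse_open /= preimage_setT; exact: openT. Qed.

Lemma collapse_openI : setI_closed collapse_open.
Proof. by move=> V W oV oW; rewrite /collapse_open /= preimage_setI; exact: openI. Qed.

Lemma collapse_open_bigU (I : Type) (f : I -> set collapse) :
  (forall i, collapse_open (f i)) -> collapse_open (\bigcup_i f i).
Proof.
by move=> fo; rewrite /collapse_open /= preimage_bigcup; apply: bigcup_open => i _; exact: fo.
Qed.

(* the final topology of [collapse_fun] *)
HB.instance Definition _ := isOpenTopological.Build collapse
  collapse_openT collapse_openI collapse_open_bigU.

Lemma collapse_openE (V : set collapse) : open V = open (collapse_fun @^-1` V).
Proof. by []. Qed.

Definition collapse_proj (p : collapse) : T :=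
  match p with inl t => val t | inr (_, t) => val t end.

Lemma collapse_funK p : collapse_proj (collapse_fun p) = p.2.
Proof. by rewrite /collapse_fun; case: pselect. Qed.

Lemma collapse_fun_in s s' t : O t -> collapse_fun (s, t) = collapse_fun (s', t).
Proof. by move=> Ot; rewrite /collapse_fun /=; case: pselect. Qed.

Lemma collapse_fun_out s s' t : ~ O t ->
  collapse_fun (s, t) = collapse_fun (s', t) -> s = s'.
Proof. by move=> nOt; rewrite /collapse_fun /=; case: pselect => // _ [->]. Qed.

Lemma collapse_fun_eq s s' t t' : collapse_fun (s, t) = collapse_fun (s', t') ->
  t = t' /\ (~ O t -> s = s').
Proof.
move=> e; have tt : t = t' by rewrite -[t](collapse_funK (s, t)) e collapse_funK.
by split=> // nOt; move: e; rewrite -tt; exact: collapse_fun_out.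
Qed.

Lemma collapse_fun_surj p : exists u, p = collapse_fun u.
Proof.
case: p => [[t Ot]|[s [t nOt]]].
  exists (S1_one R, t).
  rewrite /collapse_fun /=; case: pselect => [h|[]]; last exact/set_mem.
  by congr inl; apply/val_inj.
exists (s, t); rewrite /collapse_fun /=; case: pselect => [h|h].
  by have /set_mem := nOt.
by congr (inr (_, _)); apply/val_inj.
Qed.

End CollapseSpace.

Section CollapsePoset.
Variables (T : topologicalType) (O : set T).
Implicit Types (A : poset (S1 R)) (B : poset T).

Definition collapse_step A B : relation (collapse O) := fun p q =>
  exists u v, [/\ ple (prod_poset A B) u v, p = collapse_fun O u & q = collapse_fun O v].

Lemma collapse_clos A B p q : clos_trans _ (collapse_step A B) p q ->
  [/\ (collapse_fun O @` (A `*` B)) p, (collapse_fun O @` (A `*` B)) q,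
    ple B (collapse_proj p) (collapse_proj q) &
    collapse_proj p = collapse_proj q ->
    match p, q with
    | inl _, inl _ => True
    | inr (s, _), inr (s', _) => ple A s s'
    | _, _ => False end].
Proof.
elim=> {p q} [p q [u [v [uv -> ->]]]|p r q _ [Up Ur pr fpr] _ [_ Uq rq frq]].
  have [Au Av] := ple_pcar uv; rewrite !collapse_funK; case: (uv) => uv1 uv2.
  split; [by exists u|by exists v|by []|].
  rewrite /collapse_fun; case: pselect => Ou; case: pselect => Ov //= e.
    by apply: Ov; rewrite -e.
  by apply: Ou; rewrite e.
split=> //; first exact: ple_trans rq.
move=> pq; have pr' : collapse_proj p = collapse_proj r.
  by apply: ple_anti pr _; rewrite pq.
have := fpr pr'; have : collapse_proj r = collapse_proj q by rewrite -pr'.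
move=> /frq; clear.
case: p r q => [t|[s t]] [t'|[s' t']] [t''|[s'' t'']] // rq pr.
exact: ple_trans rq.
Qed.

Program Definition collapse_poset A B : poset (collapse O) :=
  @Poset (collapse O) (collapse_fun O @` (A `*` B))
    (clos_trans _ (collapse_step A B)) _ _ _ _.
Next Obligation. by move=> A B x y /collapse_clos[]. Qed.
Next Obligation.
by move=> A B _ [u ABu <-]; apply: t_step; exists u, u; split=> //; exact: ple_refl.
Qed.
Next Obligation.
move=> A B p q /collapse_clos[_ _ pq fpq] /collapse_clos[_ _ qp fqp].
have e := ple_anti pq qp; move: (fpq e) (fqp (esym e)) (e).
case: p q {pq qp fpq fqp e} => [t|[s t]] [t'|[s' t']] //= ss' s's /val_inj <- //.
by rewrite (ple_anti ss' s's).
Qed.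
Next Obligation. by move=> A B q p r pq qr; exact: t_trans qr. Qed.

Lemma collapse_poset_lax A B A' B' : lax_sub B B' ->
  lax_sub A A' \/ (B `<=` O /\ exists z, A' z) ->
  lax_sub (collapse_poset A B) (collapse_poset A' B').
Proof.
move=> BB' h.
have lift s t s' t' : ple (prod_poset A B) (s, t) (s', t') ->
    exists u v, [/\ ple (prod_poset A' B') u v,
      collapse_fun O (s, t) = collapse_fun O u &
      collapse_fun O (s', t') = collapse_fun O v].
  move=> [/= ss' tt']; case: h => [AA'|[BO [z Az]]].
    by exists (s, t), (s', t'); split=> //; split=> /=; [exact: lax_le ss'|exact: lax_le tt'].
  have [Bt Bt'] := ple_pcar tt'.
  exists (z, t), (z, t'); split; [split=> /=|exact/collapse_fun_in/BO..].
    exact: ple_refl.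
  exact: lax_le tt'.
split.
  move=> _ [[s t] ABst <-].
  have [u [v [uv -> _]]] := lift s t s t (@ple_refl _ (prod_poset A B) _ ABst).
  by have [ABu _] := ple_pcar uv; exists u.
move=> p q _ _ /=; elim=> [{}p {}q [[s t] [[s' t'] [uv -> ->]]]|{}p r {}q _ pr _ rq].
  by apply: t_step; have [u [v [? ? ?]]] := lift _ _ _ _ uv; exists u, v.
exact: t_trans rq.
Qed.

End CollapsePoset.

Section CollapseLospace.
Variables (X : lospace) (O : set X) (oO : open O).

Definition collapse_basis : set (poset (collapse O)) :=
  [set collapse_poset O A B | A in arcs R & B in open_poset X].

Lemma collapse_basisP : ordered_basis collapse_basis.
Proof.
have oM (V : set (S1 R)) (W : set X) : open V -> open W -> open (V `*` W).
  move=> oV oW; rewrite openE => -[s t] [/= Vs Wt].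
  by exists (V, W) => //; split; exact: open_nbhs_nbhs.
apply: ordered_basisP.
- move=> _ [A arcA [B oB <-]]; rewrite collapse_openE.
  rewrite (_ : _ @^-1` _ = (setT `*` (O `&` B)) `|` (A `*` B)).
    apply: openU; apply: oM; first exact: openT.
    + by apply: openI => //; exact: open_poset_open.
    + exact: arcs_open.
    + exact: open_poset_open.
  apply/seteqP; split=> [[s t] [[s' t'] [/= As' Bt']]|[s t] /=].
    move=> /collapse_fun_eq[tt ss]; rewrite -tt.
    have [Ot|nOt] := pselect (O t'); first by left.
    by right; rewrite -ss.
  case=> [[_ [Ot Bt]]|ABst]; last by exists (s, t).
  have [z Az] := arcs_neq0 arcA.
  by exists (z, t) => //; exact: collapse_fun_in.
- move=> p V; rewrite nbhsE => -[W [oW Wp] WV].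
  have [[s t] pst] := collapse_fun_surj p.
  have : nbhs (s, t) (@collapse_fun _ O @^-1` W).
    by apply: open_nbhs_nbhs; split=> //; rewrite /= -pst.
  move=> [[U1 U2] [/= /arcs_nbhs[A [arcA As AU]]
    /open_poset_nbhs[B [oB Bt BU]]] UW].
  exists (collapse_poset O A B); split; first by exists A => //; exists B.
    by exists (s, t).
  by move=> _ [[s' t'] [/= /AU ? /BU ?] <-]; apply: WV; exact: (UW (s', t')).
- move=> p _ _ [A arcA [B oB <-]] [A' arcA' [B' oB' <-]].
  move=> [[s t] [/= As Bt] <-] [[s' t'] [/= As' Bt']] /collapse_fun_eq[tt ss].
  move: Bt'; rewrite tt => Bt'.
  have [C [oC Ct CB CB']] := open_posetI oB oB' Bt Bt'.
  have [Ot|nOt] := pselect (O t).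
    exists (collapse_poset O A (restrict C O)); split.
    + by exists A => //; exists (restrict C O) => //; exact: open_poset_restrict.
    + by exists (s, t).
    + apply: collapse_poset_lax; first exact: lax_trans (lax_restrict _ _) CB.
      by right; split; [move=> ? []|exists s].
    + apply: collapse_poset_lax; first exact: lax_trans (lax_restrict _ _) CB'.
      by right; split; [move=> ? []|exists s'].
  move: As'; rewrite ss ?tt// => As'.
  have [D [arcD Ds DA DA']] := arcsI arcA arcA' As As'.
  exists (collapse_poset O D C); split.
  + by exists D => //; exists C.
  + by exists (s, t).
  + by apply: collapse_poset_lax => //; left.
  + by apply: collapse_poset_lax => //; left.
Qed.

Definition collapse_lospace : lospace := lospace_of_basis collapse_basisP.

Lemma collapse_map_subproof :
  @locally_increasing (lo_prod (directed_circle R) X) collapse_lospace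
    (@collapse_fun X O).
Proof.
move=> [s t]; apply/(@locally_increasing_atP (lo_prod (directed_circle R) X)
  collapse_lospace (prod_basis (arcs R) (open_poset X)) collapse_basis).
- exact: (lo_class_prod (lo_class_of_basis (@arcs_basis R)) (open_poset_class X)).
- exact: lo_class_of_basis.
- move=> _ [A arcA [B oB <-]] [[s' t'] [/= As' Bt']] /collapse_fun_eq[tt ss].
  move: Bt'; rewrite tt => Bt.
  have step C D : lax_sub (collapse_poset O C D) (collapse_poset O A B) ->
      collapse_fun O @` (C `*` D) `<=` collapse_poset O A B /\
      forall p q, ple (prod_poset C D) p q ->
        ple (collapse_poset O A B) (collapse_fun O p) (collapse_fun O q).
    move=> [CA leCA]; split=> // p q pq; have [Cp Cq] := ple_pcar pq.
    apply: leCA; [by exists p|by exists q|].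
    by apply: t_step; exists p, q.
  have [Ot|nOt] := pselect (O t).
    have [C [arcC Cs _]] := arcs_nbhs (@filterT _ _ (nbhs_filter s)).
    have [h1 h2] : _ /\ _ := step C (restrict B O) (collapse_poset_lax
      (lax_restrict _ _) (or_intror (conj (@subIsetr _ _ _) (ex_intro _ s' As')))).
    exists (prod_poset C (restrict B O)); split=> //.
    + exists C => //; exists (restrict B O) => //; exact: open_poset_restrict.
    + by move=> p q _ _; exact: h2.
  move: As'; rewrite ss ?tt// => As.
  have [h1 h2] := step A B (@lax_refl _ _).
  exists (prod_poset A B); split=> //; first by exists A => //; exists B.
  by move=> p q _ _; exact: h2.
Qed.

Definition collapse_map : lomap (lo_prod (directed_circle R) X) collapse_lospace :=
  @LOMap (lo_prod (directed_circle R) X) collapse_lospace (@collapse_fun X O) collapse_map_subproof.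

End CollapseLospace.

End Collapse.

Definition clopen_nbhd (T : topologicalType) (pt : T) (O : set T) := clopen O /\ O pt.

Definition smallest_clopen_nbhd (T : topologicalType) (pt : T) (O : set T) :=
  clopen_nbhd pt O /\ forall O', clopen_nbhd pt O' -> O `<=` O'.

(* Main.v *)
Require Import Defs.
From mathcomp Require Import all_boot all_order all_algebra.
From mathcomp Require Import all_classical all_reals.
From mathcomp Require Import topology normedtype.
From mathcomp Require Import complex trigo.
From mathcomp Require Import lra.
From Stdlib Require Import Relation_Operators.

(** The sufficient condition and the necessary one rest on a single fact: for a
    locally increasing map u from the product of the directed circle with X to
    a locally Nachbin ordered space, the set W of those t such that u(-, t) is
    constant is clopen.

    W is open because a directed circle admits no nonconstant locally increasing
    map to a poset. If u(-, t) is constant, with value in an open poset N, then by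
    compactness of the circle u(-, t') takes its values in N and is locally
    increasing into N for all t' near t ([open_constant_fibres]); going once
    around gives u(-1, t') <= u(s, t') <= u(-1, t') in N, and antisymmetry
    concludes ([locally_increasing_circle]). W is closed because a Nachbin
    order is closed: near any point (s, t) the map u lands in a Nachbin open
    poset, so that equalities u(s, t') = u(s', t') for t' in W close to t pass
    to the limit. Hence at a limit point t of W the map u(-, t) is locally
    constant on the circle, so constant ([closed_constant_fibres]).

    Suppose that O is the smallest clopen neighbourhood of the base point, and
    that u coequalizes the two circles. Then W contains the base point, so
    it contains O, so u factors through the quotient map q_O. The factor is
    locally increasing because the orders of X_O are generated by images under
    q_O ([collapse_universal]). That X_O lies in the category holds for every
    clopen O: locally X_O looks like an open poset of O or like the product
    of an arc and an open poset of the complement of O ([collapse_nachbin],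
    [collapse_strict]).

    Conversely let q be a coequalizer. Its set W is a clopen neighbourhood of
    the base point. For any other clopen neighbourhood O, the map q_O
    coequalizes the two circles, so it factors through q and is thus constant
    on the circles over W. As q_O is injective on the circles outside O, this
    forces W to be contained in O. *)

Set Implicit Arguments. Unset Strict Implicit. Unset Printing Implicit Defensive.
Import Order.TTheory GRing.Theory Num.Theory numFieldNormedType.Exports.
Local Open Scope classical_set_scope.
Local Open Scope ring_scope.

(** * Nachbin posets *)

(** A closed order on a subspace, expressed with neighbourhoods in the ambient
    space: the complement of the graph is open in the product. This form avoids
    the subspace topology of [set_type P]. *)
Definition nachbin_separated (T : topologicalType) (P : poset T) :=
  forall p q, P p -> P q -> ~ ple P p q -> exists V W,
    [/\ nbhs p V, nbhs q W & forall p' q', V p' -> W q' -> ~ ple P p' q'].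

Lemma nachbin_orderedP (T : topologicalType) (P : poset T) :
  @nachbin_ordered (set_type P) (fun a b => ple P (val a) (val b)) <->
  nachbin_separated P.
Proof.
split=> [[_ cP] p q Pp Pq npq|sP].
- move: cP; rewrite -openC openE => /(_ (exist _ p (mem_set Pp),
    exist _ q (mem_set Pq)) npq)[[V W] /= [Vp Wq] VW].
  rewrite nbhsE in Vp; rewrite nbhsE in Wq.
  move: Vp Wq => -[_ [[V' oV' <-] /= Vp] VV'] [_ [[W' oW' <-] /= Wq] WW'].
  exists V', W'; split; [exact: open_nbhs_nbhs|exact: open_nbhs_nbhs|].
  move=> p' q' Vp' Wq' le; have [Pp' Pq'] := ple_pcar le.
  apply: (VW (exist _ p' (mem_set Pp'), exist _ q' (mem_set Pq')) _ le).
  by split; [exact: VV'|exact: WW'].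
- split.
    split=> [x|x y z|x y].
    + by apply: ple_refl; exact: set_valP.
    + exact: ple_trans.
    + by move=> xy yx; apply/val_inj; exact: ple_anti yx.
  rewrite -openC openE => -[p q] /= npq.
  have [V [W [Vp Wq VW]]] := sP _ _ (set_valP p) (set_valP q) npq.
  exists (set_val @^-1` V, set_val @^-1` W).
    by split; apply: initial_continuous.
  by move=> [p' q'] [/= Vp' Wq']; exact: VW.
Qed.

Lemma prod_poset_separated (S T : topologicalType) (A : poset S) (B : poset T) :
  nachbin_separated A -> nachbin_separated B -> nachbin_separated (prod_poset A B).
Proof.
move=> sA sB [s t] [s' t'] [/= As Bt] [/= As' Bt'] /= n.
have [ss'|nss'] := pselect (ple A s s').
  have [//|V [W [Vt Wt' VW]]] := sB t t' Bt Bt'; first by move=> tt'; apply: n.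
  exists (setT `*` V), (setT `*` W); split.
  - by exists (setT, V) => //; split=> //; exact: filterT.
  - by exists (setT, W) => //; split=> //; exact: filterT.
  - by move=> [p p'] [q q'] [/= _ Vp] [/= _ Wq] [/= _]; exact: VW.
have [V [W [Vs Ws' VW]]] := sA s s' As As' nss'.
exists (V `*` setT), (W `*` setT); split.
- by exists (V, setT) => //; split=> //; exact: filterT.
- by exists (W, setT) => //; split=> //; exact: filterT.
- by move=> [p p'] [q q'] [/= Vp _] [/= Wq _] [/=]; move: (VW _ _ Vp Wq).
Qed.

(** A Nachbin order makes the space Hausdorff, since distinct points are
    unrelated in at least one direction. *)
Lemma discrete_poset_separated (T : topologicalType) (A : poset T) :
  nachbin_separated A -> nachbin_separated (discrete_poset A).
Proof.
move=> sA p q Ap Aq npq.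
have : ~ ple A p q \/ ~ ple A q p.
  by apply/not_andP => -[pq qp]; apply: npq; split=> //; exact: ple_anti qp.
case=> n.
  have [V [W [Vp Wq VW]]] := sA _ _ Ap Aq n; exists V, W; split=> // p' q' Vp' Wq'.
  by move=> [Ap' e]; apply: (VW p' q') => //; rewrite -e; exact: ple_refl.
have [V [W [Vq Wp VW]]] := sA _ _ Aq Ap n; exists W, V; split=> // p' q' Wp' Vq'.
by move=> [Ap' e]; apply: (VW q' p') => //; rewrite -e; exact: ple_refl.
Qed.

(** * Strict inclusions *)

(** Two elements of A that are related in B are comparable in A, and the wrong
    direction would contradict antisymmetry of B. *)
Lemma lax_sub_total (T : Type) (A B : poset T) :
  (forall p q, A p -> A q -> ple A p q \/ ple A q p) -> lax_sub A B -> str_sub A B.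
Proof.
move=> tot AB; split=> [|p q Ap Aq]; first exact: AB.1.
split=> [|Bpq]; first exact: AB.2.
have [//|qp] := tot p q Ap Aq.
by rewrite (ple_anti Bpq (lax_le AB qp)); exact: ple_refl.
Qed.

Lemma prod_poset_str (S T : Type) (A A' : poset S) (B B' : poset T) :
  str_sub A A' -> str_sub B B' -> str_sub (prod_poset A B) (prod_poset A' B').
Proof.
move=> [AA' oA] [BB' oB]; split=> [[s t] [/AA' ? /BB' ?] //|].
move=> [s t] [s' t'] [/= As Bt] [/= As' Bt'].
by split=> -[/= ss tt]; split; [exact/oA|exact/oB|exact/oA|exact/oB].
Qed.

(** * Arcs *)

Section Arcs.
Variable R : realType.

Lemma arc_param_inj (a b x y : R) : 0 < b - a < pi *+ 2 ->
  x \in `]a, b[ -> y \in `]a, b[ -> cis x = cis y -> x = y.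
Proof.
move=> /andP[? ?]; rewrite !in_itv /= => /andP[? ?] /andP[? ?]; apply: cis_inj.
by rewrite ltr_norml; apply/andP; split; lra.
Qed.

(** If y < x are the angles of two points of an arc, cutting the arc at an angle
    strictly between them gives the two neighbourhoods. *)
Lemma arcs_separated (A : poset (S1 R)) : arcs R A -> nachbin_separated A.
Proof.
move=> [a [b [ab ->]]] _ _ [x xab <-] [y yab <-] nxy.
have yx : y < x by rewrite ltNge; apply/negP => xy; apply: nxy; exists x, y.
pose m := (x + y) / 2.
move: (xab) (yab) (ab); rewrite /= !in_itv /= => /andP[? ?] /andP[? ?] /andP[? ?].
exists (arc_set m b), (arc_set a m); split.
- apply: open_nbhs_nbhs; split.
    by apply: open_arc_set; apply/andP; rewrite /m; split; lra.
  by exists x => //; rewrite /= in_itv /= /m; apply/andP; split; lra.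
- apply: open_nbhs_nbhs; split.
    by apply: open_arc_set; apply/andP; rewrite /m; split; lra.
  by exists y => //; rewrite /= in_itv /= /m; apply/andP; split; lra.
- move=> _ _ [x1 x1I <-] [y1 y1I <-] [x2 [y2 [x2ab y2ab x2y2 ex ey]]].
  move: x1I y1I; rewrite /= !in_itv /= /m => /andP[? ?] /andP[? ?].
  have e1 : x1 = x2.
    by apply: (arc_param_inj ab) => //; rewrite in_itv /=; apply/andP; split; lra.
  have e2 : y1 = y2.
    by apply: (arc_param_inj ab) => //; rewrite in_itv /=; apply/andP; split; lra.
  lra.
Qed.

Lemma arcs_total (A : poset (S1 R)) z w : arcs R A -> A z -> A w -> ple A z w \/ ple A w z.
Proof.
move=> [a [b [ab ->]]] [x xab <-] [y yab <-].
by have [xy|/ltW yx] := leP x y; [left; exists x, y|right; exists y, x].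
Qed.

Lemma arcs_strict (z : S1 R) (A A' : poset (S1 R)) :
  arcs R A -> arcs R A' -> A z -> A' z ->
  exists A'', [/\ arcs R A'', A'' z, str_sub A'' A & str_sub A'' A'].
Proof.
move=> arcA arcA' Az A'z; have [D [arcD Dz DA DA']] := arcsI arcA arcA' Az A'z.
by exists D; split=> //; apply: lax_sub_total => // p q; exact: arcs_total.
Qed.

End Arcs.

(** * Checking local properties on an ordered basis *)

(** Together with [strictly_locally_orderedP] and [locally_nachbinP], this lets one
    recognize a strict or a Nachbin structure from a convenient family G, without
    going back to the definition of an equivalence class of bases. *)
Lemma open_poset_lo_class (Y : lospace) (G : set (poset Y)) :
  G `<=` open_poset Y -> coarser (open_poset Y) G -> lo_class Y G.
Proof.
move=> Go oG.
have Gb : ordered_basis G.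
  apply: ordered_basisP.
  - by move=> B /Go; exact: open_poset_open.
  - move=> x V /open_poset_nbhs[A [oA Ax AV]].
    have [B [GB Bx [BA _]]] := oG _ _ oA Ax.
    by exists B; split=> //; exact: subset_trans AV.
  - move=> x B B' /Go oB /Go oB' Bx B'x.
    have [A [oA Ax AB AB']] := open_posetI oB oB' Bx B'x.
    have [D [GD Dx DA]] := oG _ _ oA Ax.
    by exists D; split=> //; exact: lax_trans DA _.
have [F0 F0b eF] := lo_classP Y.
have := open_poset_class Y; rewrite eF => -[ob [oF Fo]].
rewrite /=; do 2!split=> //.
- exact: coarser_trans oG.
- by apply: coarser_trans Fo => x B /Go oB Bx; exact: coarser_refl.
Qed.

Lemma strictly_locally_orderedP (Y : lospace) (G : set (poset Y)) :
  lo_class Y G ->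
  (forall x B B', G B -> G B' -> B x -> B' x ->
    exists B'', [/\ G B'', B'' x, str_sub B'' B & str_sub B'' B']) ->
  strictly_locally_ordered Y.
Proof. by move=> YG Gs; exists G => //; split=> //; exact: lo_class_basis YG. Qed.

Lemma locally_nachbinP (Y : lospace) (G : set (poset Y)) : lo_class Y G ->
  (forall x B, G B -> B x -> exists P, [/\ open_poset Y P, P x, lax_sub P B &
    nachbin_separated P]) -> locally_nachbin Y.
Proof.
move=> YG h x A /(_ _ YG)/[apply] -[B [GB Bx BA]].
have [P [oP Px PB sP]] := h _ _ GB Bx.
by exists P; split=> //; [exact: lax_trans BA|apply/nachbin_orderedP].
Qed.

Lemma locally_nachbin_separated (Y : lospace) (x : Y) (A : poset Y) :
  locally_nachbin Y -> open_poset Y A -> A x ->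
  exists P, [/\ open_poset Y P, P x, lax_sub P A & nachbin_separated P].
Proof.
move=> nY oA /(nY _ _ oA)[P [oP Px PA nP]].
by exists P; split=> //; apply/nachbin_orderedP.
Qed.

(** * Circles and products *)

Section CircleSpaces.
Variable R : realType.

Lemma directed_circle_nachbin : locally_nachbin (directed_circle R).
Proof.
apply: (locally_nachbinP (lo_class_of_basis (@arcs_basis R))) => z A arcA Az.
exists A; split=> //; [|exact: lax_refl|exact: arcs_separated].
exact: (class_open_poset (lo_class_of_basis (@arcs_basis R)) arcA).
Qed.

Lemma directed_circle_strict : strictly_locally_ordered (directed_circle R).
Proof.
apply: (strictly_locally_orderedP (lo_class_of_basis (@arcs_basis R))).
exact: arcs_strict.
Qed.

Lemma unordered_circle_nachbin : locally_nachbin (unordered_circle R).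
Proof.
have cl := lo_class_of_basis (@discrete_arcs_basis R).
apply: (locally_nachbinP cl) => z _ [A arcA <-] Az.
exists (discrete_poset A); split=> //.
- by apply: (class_open_poset cl); exists A.
- exact: lax_refl.
- exact/discrete_poset_separated/arcs_separated.
Qed.

Lemma unordered_circle_strict : strictly_locally_ordered (unordered_circle R).
Proof.
apply: (strictly_locally_orderedP (lo_class_of_basis (@discrete_arcs_basis R))).
move=> z _ _ [A arcA <-] [A' arcA' <-] Az A'z.
have [D [arcD Dz [DA _] [DA' _]]] := arcsI arcA arcA' Az A'z.
exists (discrete_poset D); split=> //; first by exists D.
- by split=> // p q Dp _; split=> -[_ <-]; split=> //; exact: DA.
- by split=> // p q Dp _; split=> -[_ <-]; split=> //; exact: DA'.
Qed.

End CircleSpaces.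

Section ProductSpaces.
Variables X Y : lospace.

Lemma lo_prod_nachbin : locally_nachbin X -> locally_nachbin Y ->
  locally_nachbin (lo_prod X Y).
Proof.
move=> nX nY; have cl := lo_class_prod (open_poset_class X) (open_poset_class Y).
apply: (locally_nachbinP cl) => -[x y] _ [A oA [B oB <-]] [/= Ax By].
have [P [oP Px PA sP]] := locally_nachbin_separated nX oA Ax.
have [Q [oQ Qy QB sQ]] := locally_nachbin_separated nY oB By.
exists (prod_poset P Q); split=> //.
- by apply: (class_open_poset cl); exists P => //; exists Q.
- split=> [[s t] [/PA.1 ? /QB.1 ?] //|[s t] [s' t'] _ _ [/= ss tt]].
  by split; [exact: lax_le ss|exact: lax_le tt].
- exact: prod_poset_separated.
Qed.

Lemma lo_prod_strict : strictly_locally_ordered X -> strictly_locally_ordered Y ->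
  strictly_locally_ordered (lo_prod X Y).
Proof.
move=> [F XF [_ Fs]] [G YG [_ Gs]].
apply: (strictly_locally_orderedP (lo_class_prod XF YG)).
move=> [x y] _ _ [A FA [B GB <-]] [A' FA' [B' GB' <-]] [/= Ax By] [/= A'x B'y].
have [P [FP Px PA PA']] := Fs _ _ _ FA FA' Ax A'x.
have [Q [GQ Qy QB QB']] := Gs _ _ _ GB GB' By B'y.
exists (prod_poset P Q); split=> //; first by exists P => //; exists Q.
- exact: prod_poset_str.
- exact: prod_poset_str.
Qed.

End ProductSpaces.

(** * The collapsed space *)

Section CollapseOrder.
Variables (R : realType) (T : topologicalType) (O : set T).
Implicit Types (A : poset (S1 R)) (B : poset T).

(** The transitive closure in the order of X_O does nothing over a set B that
    does not meet both O and its complement. Outside O the quotient map is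
    injective; inside O, two consecutive steps can be composed because the
    circle coordinate of the middle point is immaterial. *)
Lemma collapse_poset_step A B p q : B `<=` O \/ B `<=` ~` O ->
  ple (collapse_poset O A B) p q -> collapse_step A B p q.
Proof.
move=> BO; elim=> [//|{}p r {}q _ [u [v [uv -> ->]]] _ [v' [w [vw erv ->]]]].
have [/= uv1 uv2] := uv; have [/= vw1 vw2] := vw.
move: u v v' w {uv vw} erv uv1 uv2 vw1 vw2.
move=> [s t] [s' t'] [s1 t1] [s2 t2] /collapse_fun_eq/= [<- es] ss tt ss' tt'.
case: BO => BO.
  (* Over O the circle coordinate s serves as both endpoints of the long step. *)
  have [As _] := ple_pcar ss; have [Bt _] := ple_pcar tt; have [_ Bt2] := ple_pcar tt'.
  exists (s, t), (s, t2); split.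
  - by split; [exact: ple_refl|exact: ple_trans tt'].
  - by [].
  - exact/collapse_fun_in/BO.
exists (s, t), (s2, t2); split=> //; split=> /=; last exact: ple_trans tt'.
apply: ple_trans ss _; rewrite es //.
by apply: BO; have [] := ple_pcar tt.
Qed.

Lemma ple_collapse A B u v : ple (prod_poset A B) u v ->
  ple (collapse_poset O A B) (collapse_fun O u) (collapse_fun O v).
Proof. by move=> uv; apply: t_step; exists u, v. Qed.

Lemma ple_collapse_in A B s t s' t' : A s -> A s' -> B `<=` O ->
  ple (collapse_poset O A B) (collapse_fun O (s, t)) (collapse_fun O (s', t')) <->
  ple B t t'.
Proof.
move=> As As' BO; split=> [/collapse_clos[_ _ + _]|tt]; first by rewrite !collapse_funK.
rewrite (@collapse_fun_in _ _ _ s' s); last by apply: BO; have [] := ple_pcar tt.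
by apply: ple_collapse; split=> //; exact: ple_refl.
Qed.

Lemma collapse_fun_inj (s s' : S1 R) t t' : ~ O t ->
  collapse_fun O (s, t) = collapse_fun O (s', t') -> (s, t) = (s', t').
Proof. by move=> nOt /collapse_fun_eq[<- ->]. Qed.

Lemma ple_collapse_out A B u v : B `<=` ~` O -> (A `*` B) u -> (A `*` B) v ->
  ple (collapse_poset O A B) (collapse_fun O u) (collapse_fun O v) <->
  ple (prod_poset A B) u v.
Proof.
move: u v => [s t] [s' t'] BO [/= As Bt] [/= As' Bt'].
split=> [/(collapse_poset_step (or_intror BO))|]; last first.
  exact: (@ple_collapse A B (s, t) (s', t')).
move=> [[s1 t1] [[s2 t2] [ss]]].
by move=> /(collapse_fun_inj (BO _ Bt))[-> ->] /(collapse_fun_inj (BO _ Bt'))[-> ->].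
Qed.

Lemma collapse_poset_str_out A A' B B' : str_sub A A' -> str_sub B B' ->
  B' `<=` ~` O -> str_sub (collapse_poset O A B) (collapse_poset O A' B').
Proof.
move=> AA' BB' BO; split=> [_ [[s t] [/= As Bt] <-]|].
  by exists (s, t) => //; split; [exact: AA'.1|exact: BB'.1].
move=> _ _ [[s t] [/= As Bt] <-] [[s' t'] [/= As' Bt'] <-].
have BO' : B `<=` ~` O by move=> ? /BB'.1/BO.
apply: iff_trans (@ple_collapse_out A B (s, t) (s', t') BO' (conj As Bt) (conj As' Bt')) _.
apply: iff_trans (iff_sym (@ple_collapse_out A' B' (s, t) (s', t') BO _ _)).
- by rewrite /= AA'.2 // BB'.2.
- by split; [exact: AA'.1|exact: BB'.1].
- by split; [exact: AA'.1|exact: BB'.1].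
Qed.

Lemma collapse_poset_str_in A A' B B' : (exists z, A' z) -> str_sub B B' ->
  B' `<=` O -> str_sub (collapse_poset O A B) (collapse_poset O A' B').
Proof.
move=> [z A'z] BB' BO; have BO' : B `<=` O by move=> ? /BB'.1/BO.
split=> [_ [[s t] [/= As Bt] <-]|].
  exists (z, t); first by split=> //; exact: BB'.1.
  exact/collapse_fun_in/BO'.
move=> _ _ [[s t] [/= As Bt] <-] [[s' t'] [/= As' Bt'] <-].
apply: iff_trans (ple_collapse_in t t' As As' BO') _.
rewrite (collapse_fun_in s z (BO' _ Bt)) (collapse_fun_in s' z (BO' _ Bt')).
by apply: iff_trans (iff_sym (ple_collapse_in t t' A'z A'z BO)); exact: BB'.2.
Qed.

Lemma continuous_collapse_proj :
  continuous (@collapse_proj R T O).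
Proof.
apply/continuousP => V oV; rewrite collapse_openE.
rewrite (_ : _ @^-1` _ = snd @^-1` V); last first.
  by apply/seteqP; split=> u; rewrite /= collapse_funK.
by apply: open_comp => // u _; exact: cvg_snd.
Qed.

Lemma collapse_box_nbhs s t (V : set (S1 R)) (W : set T) : nbhs s V -> nbhs t W ->
  W `<=` ~` O -> open W -> nbhs (collapse_fun O (s, t)) (collapse_fun O @` (V `*` W)).
Proof.
move=> Vs Wt WO oW.
apply: (@filterS _ _ _ (collapse_fun O @` (V^° `*` W))).
  by move=> _ [[a b] [/= /interior_subset ? ?] <-]; exists (a, b).
apply: open_nbhs_nbhs; split; last first.
  by exists (s, t) => //; split=> //=; exact: nbhs_singleton.
rewrite collapse_openE (_ : _ @^-1` _ = V^° `*` W).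
  have oV : open V^° by exact: open_interior.
  rewrite openE => -[a b] [/= Va Wb].
  by exists (V^°, W) => //; split; exact: open_nbhs_nbhs.
apply/seteqP; split=> [[a b] [[a' b'] [/= Va Wb]]|[a b] ?]; last by exists (a, b).
by move=> /(collapse_fun_inj (WO _ Wb)) [<- <-].
Qed.

(** Two unrelated points are separated either by their coordinates in T, through the
    continuous projection, or, when those are comparable, by their circle
    coordinates; the latter can only happen outside O, where boxes are open. *)
Lemma collapse_poset_separated A B : B `<=` O \/ B `<=` ~` O -> open (pcar B) ->
  nachbin_separated A -> nachbin_separated B ->
  nachbin_separated (collapse_poset O A B).
Proof.
move=> BO oB sA sB _ _ [[s t] [/= As Bt] <-] [[s' t'] [/= As' Bt'] <-] n.
have [tt|ntt] := pselect (ple B t t'); last first.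
  have [V [W [Vt Wt' VW]]] := sB _ _ Bt Bt' ntt.
  exists (@collapse_proj R T O @^-1` V), (@collapse_proj R T O @^-1` W); split.
  - by apply: continuous_collapse_proj; rewrite collapse_funK.
  - by apply: continuous_collapse_proj; rewrite collapse_funK.
  - by move=> p' q' Vp' Wq' /collapse_clos[_ _ + _]; exact: VW.
case: BO => BO; first by case: n; apply/ple_collapse_in.
have [ss|nss] := pselect (ple A s s'); first by case: n; exact: ple_collapse.
have [V [W [Vs Ws' VW]]] := sA _ _ As As' nss.
exists (collapse_fun O @` (V `*` B)), (collapse_fun O @` (W `*` B)); split.
- by apply: collapse_box_nbhs => //; exact: open_nbhs_nbhs.
- by apply: collapse_box_nbhs => //; exact: open_nbhs_nbhs.
- move=> _ _ [[a b] [/= Va Bb] <-] [[a' b'] [/= Wa' Bb'] <-].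
  move=> /(collapse_poset_step (or_intror BO))[[a1 b1] [[a2 b2] [[/= aa _]]]].
  move=> /(collapse_fun_inj (BO _ Bb)) [e1 _] /(collapse_fun_inj (BO _ Bb')) [e2 _].
  by apply: VW aa; rewrite -?e1 -?e2.
Qed.

End CollapseOrder.

Section CollapseSpace.
Variables (R : realType) (X : lospace) (O : set X) (cO : clopen O).
Let oO : open O := cO.1.

(** Since O is clopen, open posets that lie on one side of O suffice near each
    point, and on each side the order of X_O is explicit. *)
Lemma open_poset_split (x : X) (A : poset X) : open_poset X A -> A x ->
  exists B, [/\ open_poset X B, B x, lax_sub B A & B `<=` O \/ B `<=` ~` O].
Proof.
move=> oA Ax; have [Ox|nOx] := pselect (O x).
  exists (Defs.restrict A O); split=> //; [exact: open_poset_restrict| |left].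
    exact: lax_restrict.
  by move=> ? [].
exists (Defs.restrict A (~` O)); split=> //.
- by apply: open_poset_restrict => //; rewrite openC; exact: cO.2.
- exact: lax_restrict.
- by right=> ? [].
Qed.

Lemma collapse_nachbin : locally_nachbin X ->
  locally_nachbin (collapse_lospace R oO).
Proof.
move=> nX; have cl := lo_class_of_basis (@collapse_basisP R X O oO).
apply: (locally_nachbinP cl) => _ _ [A arcA [B oB <-]] [[s t] [/= As Bt] <-].
have [D [oD Dt DB DO]] := open_poset_split oB Bt.
have [P [oP Pt PD sP]] := locally_nachbin_separated nX oD Dt.
exists (collapse_poset O A P); split.
- by apply: (class_open_poset cl); exists A => //; exists P.
- by exists (s, t).
- apply: collapse_poset_lax; first exact: lax_trans DB.
  by left; exact: lax_refl.
- apply: collapse_poset_separated => //; last exact: arcs_separated.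
  + by case: DO => DO; [left|right] => y /PD.1; exact: DO.
  + exact: open_poset_open.
Qed.

(** The strict basis of X_O comes from the members of a strict basis of X that
    lie on one side of O; over a set B that crosses the boundary, points outside
    O may be related only through points of O, a relation lost in smaller sets. *)
Lemma collapse_strict : strictly_locally_ordered X ->
  strictly_locally_ordered (collapse_lospace R oO).
Proof.
move=> [F XF [_ Fs]].
pose G : set (poset (collapse_lospace R oO)) :=
  [set collapse_poset O A B | A in arcs R & B in [set B | F B /\
    (B `<=` O \/ B `<=` ~` O)]].
have cl := lo_class_of_basis (@collapse_basisP R X O oO).
apply: (@strictly_locally_orderedP _ G).
  apply: open_poset_lo_class => [_ [A arcA [B [FB _] <-]]|].
    apply: (class_open_poset cl); exists A => //; exists B => //.
    exact: class_open_poset FB.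
  move=> p P oP Pp; have [_ [[A arcA [B oB <-]] ABp ABP]] := oP _ cl _ Pp.
  case: ABp => -[s t] [/= As Bt] e.
  have [D [oD Dt DB DO]] := open_poset_split oB Bt.
  have [E [FE Et ED]] := oD _ XF _ Dt.
  exists (collapse_poset O A E); split.
  - exists A => //; exists E => //; split=> //.
    by case: DO => DO; [left|right] => y /ED.1; exact: DO.
  - by exists (s, t).
  - apply: lax_trans ABP; apply: collapse_poset_lax; first exact: lax_trans DB.
    by left; exact: lax_refl.
move=> p _ _ [A arcA [B [FB BO] <-]] [A' arcA' [B' [FB' BO'] <-]].
move=> [[s t] [/= As Bt] <-] [[s' t'] [/= As' Bt'] /collapse_fun_eq[ett es]].
rewrite ett in Bt' es.
have [E [FE Et EB EB']] := Fs _ _ _ FB FB' Bt Bt'.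
have inO (C : poset X) : C t -> O t -> C `<=` O \/ C `<=` ~` O -> C `<=` O.
  by move=> Ct Ot [//|] /(_ _ Ct).
have [Ot|nOt] := pselect (O t).
  exists (collapse_poset O A E); split.
  - by exists A => //; exists E => //; split=> //; left=> y /EB.1; exact: inO.
  - by exists (s, t).
  - by apply: collapse_poset_str_in => //; [exists s|exact: inO BO].
  - by apply: collapse_poset_str_in => //; [exists s'|exact: inO BO'].
have outO (C : poset X) : C t -> C `<=` O \/ C `<=` ~` O -> C `<=` ~` O.
  by move=> Ct [/(_ _ Ct)|].
rewrite es // in As'.
have [D [arcD Ds DA DA']] := arcs_strict arcA arcA' As As'.
exists (collapse_poset O D E); split.
- by exists D => //; exists E => //; split=> //; right=> y /EB.1; exact: outO.
- by exists (s, t).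
- by apply: collapse_poset_str_out => //; exact: outO BO.
- by apply: collapse_poset_str_out => //; exact: outO BO'.
Qed.

End CollapseSpace.

(** * Maps that are constant on a circle *)

Section AroundTheCircle.
Variable R : realType.

(** A step size that is valid uniformly on [a, b] exists by compactness; finitely
    many steps of that size then join c to d by transitivity. This serves both
    for monotonicity and, with r an equality of values, for local constancy. *)
Lemma locally_transitive (r : R -> R -> Prop) (a b : R) :
  (forall x y z, r x y -> r y z -> r x z) ->
  (forall x, a <= x <= b -> exists2 e, 0 < e & forall x1 x2,
    x - e < x1 -> x1 <= x2 -> x2 < x + e -> r x1 x2) ->
  forall c d, a <= c -> c <= d -> d <= b -> r c d.
Proof.
move=> tr loc.
pose P e x := forall x1 x2, x - e < x1 -> x1 <= x2 -> x2 < x + e -> r x1 x2.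
have /compact_near_coveringP cov := @segment_compact R a b.
have : \forall e \near 0^'+, `[a, b]%classic `<=` P e.
  apply: cov => x; rewrite /= in_itv /= => /loc[e0 e00 he0].
  exists (ball x (e0 / 2), [set e | e < e0 / 2]); first split => /=.
  - by apply: nbhsx_ballx; rewrite divr_gt0.
  - by apply: nbhs_right_lt; rewrite divr_gt0.
  - move=> [x' e] [/= + ee]; rewrite /ball /= ltr_norml => /andP[? ?].
    by move=> x1 x2 ? ? ?; apply: he0 => //; lra.
move=> /(filterI (nbhs_right_gt 0)) /filter_ex[e [/= e0 he]].
(* Steps of length e / 2 stay within the open interval of radius e. *)
have main n c d : a <= c -> c <= d -> d <= b -> d - c < n%:R * (e / 2) -> r c d.
  elim: n c d => [|n IH] c d ac cd db h; first by move: h; rewrite mul0r; lra.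
  have [dc|dc] := leP d (c + e / 2).
    by apply: (he c) => //; [rewrite /= in_itv /=; apply/andP; split|..]; lra.
  apply: (tr _ (d - e / 2)).
    apply: IH => //; [lra|lra|].
    by move: h; rewrite -natr1 mulrDl mul1r; lra.
  by apply: (he (d - e / 2)); [rewrite /= in_itv /=; apply/andP; split|..]; lra.
move=> c d ac cd db; apply: (main (Num.truncn ((d - c) / (e / 2))).+1) => //.
by rewrite -ltr_pdivrMr ?divr_gt0 // truncnS_gt.
Qed.

Lemma cis_surj_pi (s : S1 R) : exists2 x, - pi <= x <= pi & s = cis x.
Proof.
have [y ->] := cis_surj s.
have c1 : -1 <= cos y <= 1 by rewrite cos_geN1 cos_le1.
have a0 := acos_ge0 c1; have api := acos_lepi c1; have p0 := pi_gt0 R.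
have ca : cos (acos (cos y)) = cos y by rewrite acosK // in_itv.
have : (sin (acos (cos y))) ^+ 2 = (sin y) ^+ 2 by rewrite !sin2cos2 ca.
move=> /eqP; rewrite eqf_sqr => /orP[/eqP sa|/eqP sa].
  by exists (acos (cos y)); [apply/andP; split; lra|apply/val_inj; rewrite /= ca sa].
exists (- acos (cos y)); first by apply/andP; split; lra.
by apply/val_inj; rewrite /= cosN sinN ca sa opprK.
Qed.

Lemma cis_Npi : cis (- pi) = cis pi :> S1 R.
Proof. by apply/val_inj; rewrite /= cosN sinN sinpi oppr0. Qed.

Lemma arcs_cis_increasing (A : poset (S1 R)) (x : R) : arcs R A -> A (cis x) ->
  exists2 e, 0 < e & forall x1 x2, x - e < x1 -> x1 <= x2 -> x2 < x + e ->
    ple A (cis x1) (cis x2).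
Proof.
move=> [a [b [ab ->]]] [x0 + exx]; rewrite /= in_itv /= => /andP[? ?].
exists (Num.min (x0 - a) (b - x0)); first by rewrite lt_min; apply/andP; split; lra.
move=> x1 x2 h1 h12 h2.
have m1 : Num.min (x0 - a) (b - x0) <= x0 - a by rewrite ge_min lexx.
have m2 : Num.min (x0 - a) (b - x0) <= b - x0 by rewrite ge_min lexx orbT.
exists (x1 + (x0 - x)), (x2 + (x0 - x)); rewrite !in_itv /=; split.
- by apply/andP; split; lra.
- by apply/andP; split; lra.
- lra.
- by rewrite (@cis_shift _ x x0).
- by rewrite (@cis_shift _ x x0).
Qed.

Lemma locally_constant_circle (Z : Type) (f : S1 R -> Z) :
  (forall x, exists2 e, 0 < e & forall x1 x2, x - e < x1 -> x1 <= x2 ->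
    x2 < x + e -> f (cis x1) = f (cis x2)) ->
  forall s s', f s = f s'.
Proof.
move=> loc.
have h c d : c <= d -> f (cis c) = f (cis d).
  move=> cd; apply: (@locally_transitive (fun x y => f (cis x) = f (cis y)) c d) => //.
  by move=> x y z ->.
move=> s s'; have [x ->] := cis_surj s; have [y ->] := cis_surj s'.
by have [/h|/ltW/h ->] := leP x y.
Qed.

(** The fundamental reason why directed loops collapse in a poset: the values at
    the angles -pi and pi agree and bound all the others. *)
Lemma locally_increasing_circle (Z : Type) (N : poset Z) (f : S1 R -> Z) :
  (forall x, - pi <= x <= pi -> exists2 e, 0 < e & forall x1 x2, x - e < x1 ->
    x1 <= x2 -> x2 < x + e -> ple N (f (cis x1)) (f (cis x2))) ->
  forall s s', f s = f s'.
Proof.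
move=> loc.
have h := @locally_transitive (fun x y => ple N (f (cis x)) (f (cis y))) (- pi) pi
  (fun _ _ _ => @ple_trans _ _ _ _ _) loc.
have c s : f s = f (cis pi).
  have [x /andP[? ?] ->] := cis_surj_pi s.
  by apply: (@ple_anti _ N); [apply: h|rewrite -cis_Npi; apply: h] => //; lra.
by move=> s s'; exact: etrans (c s) (esym (c s')).
Qed.

End AroundTheCircle.

Section Fibres.
Variables (R : realType) (X Z : lospace).
Variable u : lomap (lo_prod (directed_circle R) X) Z.

Definition constant_fibres : set X := [set t | forall s s', u (s, t) = u (s', t)].

Lemma lomap_box s t (N : poset Z) : open_poset Z N -> N (u (s, t)) ->
  exists A B, [/\ arcs R A, open_poset X B, A s, B t &
    forall p q, ple (prod_poset A B) p q -> ple N (u p) (u q)].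
Proof.
move=> oN Nu.
have [_ [[A arcA [B oB <-]] [As Bt] _ le]] := lofunP (lo_class_prod
  (lo_class_of_basis (@arcs_basis R)) (open_poset_class X)) (open_poset_class Z) oN Nu.
by exists A, B; split=> // p q pq; have [? ?] := ple_pcar pq; exact: le.
Qed.

(** This is [lomap_box] with the arc replaced by an interval of angles, so that the
    arguments on the real line apply. *)
Lemma lomap_strip x t (N : poset Z) : open_poset Z N -> N (u (cis x, t)) ->
  exists e B, [/\ 0 < e, open_poset X B, B t & forall t' x1 x2, B t' ->
    x - e < x1 -> x1 <= x2 -> x2 < x + e -> ple N (u (cis x1, t')) (u (cis x2, t'))].
Proof.
move=> oN /(lomap_box oN)[A [B [arcA oB Ax Bt le]]].
have [e e0 he] := arcs_cis_increasing arcA Ax.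
exists e, B; split=> // t' x1 x2 Bt' h1 h12 h2; apply: le.
by split; [exact: he|exact: ple_refl].
Qed.

Lemma lomap_continuous_fibre s t (V : set Z) : nbhs (u (s, t)) V ->
  nbhs t [set t' | V (u (s, t'))].
Proof.
move=> /open_poset_nbhs[N [oN Nu NV]].
have [A [B [arcA oB As Bt le]]] := lomap_box oN Nu.
apply: (@filterS _ _ _ (B : set X)).
  move=> t' Bt' /=; apply: NV.
  have Nt' : ple N (u (s, t')) (u (s, t')) by apply: le; split; exact: ple_refl.
  by have [] := ple_pcar Nt'.
by apply: open_nbhs_nbhs; split=> //; exact: open_poset_open.
Qed.

(** A tube argument: the compact set of angles [-pi, pi] is covered by finitely
    many strips, so all fibres near a constant one map increasingly to one and
    the same poset N. *)
Lemma open_constant_fibres : open constant_fibres.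
Proof.
rewrite openE => t Wt.
have [N [oN Nu _]] := open_poset_nbhs (@filterT _ _ (nbhs_filter (u (cis 0, t)))).
pose P t' x := exists2 e, 0 < e & forall x1 x2, x - e < x1 -> x1 <= x2 -> x2 < x + e ->
  ple N (u (cis x1, t')) (u (cis x2, t')).
have /compact_near_coveringP cov := @segment_compact R (- pi) pi.
have : \forall t' \near t, `[- pi, pi]%classic `<=` P t'.
  apply: cov => x _.
  have Nx : N (u (cis x, t)) by rewrite (Wt _ (cis 0)).
  have [e [B [e0 oB Bt le]]] := lomap_strip oN Nx.
  exists (ball x (e / 2), B : set X); first split => /=.
  - by apply: nbhsx_ballx; rewrite divr_gt0.
  - by apply: open_nbhs_nbhs; split=> //; exact: open_poset_open.
  - move=> [x' t'] [/= + Bt']; rewrite /ball /= ltr_norml => /andP[? ?].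
    exists (e / 2); first by rewrite divr_gt0.
    by move=> x1 x2 ? ? ?; apply: le => //; lra.
apply: filterS => t' Pt'.
apply: (@locally_increasing_circle _ _ N (fun s => u (s, t'))) => x xpi.
by apply: Pt'; rewrite /= in_itv.
Qed.

(** Only the values at two nearby angles are compared, since Z need not be
    Hausdorff: both values lie in one Nachbin poset N, where limits of the
    relation u(s, t') <= u(s', t') are again such relations. *)
Lemma closed_constant_fibres : locally_nachbin Z -> closed constant_fibres.
Proof.
move=> nZ t clt.
apply: (@locally_constant_circle _ _ (fun s => u (s, t))) => x.
have [N0 [oN0 N0u _]] := open_poset_nbhs (@filterT _ _ (nbhs_filter (u (cis x, t)))).
have [N [oN Nu _ sN]] := locally_nachbin_separated nZ oN0 N0u.
have [e [B [e0 oB Bt le]]] := lomap_strip oN Nu.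
have Bn : nbhs t (B : set X).
  by apply: open_nbhs_nbhs; split=> //; exact: open_poset_open.
have key s s' : N (u (s, t)) -> N (u (s', t)) ->
    (forall t', B t' -> N (u (s, t'))) -> ple N (u (s, t)) (u (s', t)).
  move=> Ns Ns' BN; apply: contrapT => n.
  have [V [W [Vs Ws' VW]]] := sN _ _ Ns Ns' n.
  have [t' [ct' [Bt' [Vt' Wt']]]] := clt _ (filterI Bn (filterI
    (lomap_continuous_fibre Vs) (lomap_continuous_fibre Ws'))).
  by apply: (VW _ _ Vt' Wt'); rewrite (ct' s' s); apply: ple_refl; exact: BN.
exists e => // x1 x2 h1 h12 h2.
have N1 t' : B t' -> N (u (cis x1, t')).
  by move=> Bt'; have [] := ple_pcar (le t' x1 x2 Bt' h1 h12 h2).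
have N2 t' : B t' -> N (u (cis x2, t')).
  by move=> Bt'; have [] := ple_pcar (le t' x1 x2 Bt' h1 h12 h2).
by apply: (@ple_anti _ N); apply: key => //; [exact: N1|exact: N2|exact: N2|exact: N1].
Qed.

Lemma clopen_constant_fibres : locally_nachbin Z -> clopen constant_fibres.
Proof. by split; [exact: open_constant_fibres|exact: closed_constant_fibres]. Qed.

End Fibres.

(** * The universal property *)

Section Factor.
Variables (R : realType) (X Z : lospace) (O : set X) (oO : open O).
Variables (u : lomap (lo_prod (directed_circle R) X) Z).

Definition collapse_lift (p : collapse R O) : Z :=
  match p with inl t => u (S1_one R, val t) | inr (s, t) => u (s, val t) end.

Lemma collapse_liftK p : O `<=` constant_fibres u ->
  collapse_lift (collapse_fun O p) = u p.
Proof.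
case: p => s t Ou; rewrite /collapse_fun; case: pselect => //= Ot.
exact: Ou.
Qed.

(** The image of a box A x B is a basic open set of X_O, and its order is generated
    by images of related pairs, on which the lift agrees with u. *)
Lemma collapse_lift_subproof : O `<=` constant_fibres u ->
  @locally_increasing (collapse_lospace R oO) Z collapse_lift.
Proof.
move=> Ou p; apply/(@locally_increasing_atP (collapse_lospace R oO) Z
  (@collapse_basis R X O) (open_poset Z)).
- exact: lo_class_of_basis.
- exact: open_poset_class.
have [[s t] ->] := collapse_fun_surj p => N oN; rewrite collapse_liftK // => Nu.
have [A [B [arcA oB As Bt le]]] := lomap_box oN Nu.
exists (collapse_poset O A B); split.
- by exists A => //; exists B.
- by exists (s, t).
- move=> _ [_ [v ABv <-] <-]; rewrite collapse_liftK //.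
  by have [] := ple_pcar (le v v (@ple_refl _ (prod_poset A B) _ ABv)).
- move=> q r _ _; elim=> [{}q {}r [v [w [vw -> ->]]]|{}q w {}r _ qw _ wr].
    by rewrite !collapse_liftK //; exact: le.
  exact: ple_trans wr.
Qed.

End Factor.

Lemma lomap_inj (X Y : lospace) (f g : lomap X Y) : f =1 g -> f = g.
Proof.
case: f g => [f lf] [g lg] /= /funext fg; move: lf; rewrite fg => lf.
by congr LOMap; exact: Prop_irrelevance.
Qed.

Lemma collapse_universal (R : realType) (X Z : lospace) (O : set X) (oO : open O)
    (u : lomap (lo_prod (directed_circle R) X) Z) :
  O `<=` constant_fibres u ->
  exists! h : lomap (collapse_lospace R oO) Z, h \o collapse_map R oO =1 u.
Proof.
move=> Ou; exists (LOMap (collapse_lift_subproof (oO := oO) Ou)); split=> [p|h hu].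
  exact: collapse_liftK.
apply: lomap_inj => p; have [v ->] := collapse_fun_surj p.
by rewrite -[RHS]/((h \o collapse_map R oO) v) hu; exact: collapse_liftK.
Qed.

Theorem corollary3p17 (R : realType) (C : lospace -> Prop)
  (hC : C = locally_nachbin \/ C = strictly_locally_nachbin)
  (X : lospace) (hX : C X) (pt : X) :
  ((exists (Q : lospace) (q : lomap (lo_prod (directed_circle R) X) Q),
      is_coequalizer C (base_circle R pt) (base_const R pt) q) <->
   (exists O : set X, smallest_clopen_nbhd pt O)) /\
  (forall (O : set X) (oO : open O), smallest_clopen_nbhd pt O ->
    is_coequalizer C (base_circle R pt) (base_const R pt) (collapse_map R oO)).
Proof.
have nC Z : C Z -> locally_nachbin Z by case: hC => -> // -[].
have [Cs Ct] : C (unordered_circle R) /\ C (lo_prod (directed_circle R) X).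
  have [nU nD] := (@unordered_circle_nachbin R, @directed_circle_nachbin R).
  have nP := lo_prod_nachbin nD (nC _ hX).
  case: hC hX => -> // -[sX _]; do 2!split=> //; first exact: unordered_circle_strict.
  exact: lo_prod_strict (directed_circle_strict R) sX.
have Cc (O : set X) (oO : open O) : clopen O -> C (collapse_lospace R oO).
  move=> [oO' cO]; rewrite (Prop_irrelevance oO (conj oO' cO).1).
  have nO := @collapse_nachbin R X O (conj oO' cO) (nC _ hX).
  case: hC hX => -> // -[sX _]; split=> //; exact: collapse_strict.
have eqc (O : set X) (oO : open O) : O pt ->
    collapse_map R oO \o base_circle R pt =1 collapse_map R oO \o base_const R pt.
  by move=> Opt s; exact: collapse_fun_in.
have const_pt Z (u : lomap (lo_prod (directed_circle R) X) Z) :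
    u \o base_circle R pt =1 u \o base_const R pt -> constant_fibres u pt.
  by move=> uc s s'; exact: etrans (uc s) (esym (uc s')).
have coeq (O : set X) (oO : open O) : smallest_clopen_nbhd pt O ->
    is_coequalizer C (base_circle R pt) (base_const R pt) (collapse_map R oO).
  move=> [[cO Opt] Omin]; split=> //; [exact: Cc|exact: eqc|].
  move=> Z u CZ uc; apply: collapse_universal; apply: Omin; split.
    exact: clopen_constant_fibres (nC _ CZ).
  exact: const_pt.
split=> //; split=> [[Q [q cq]]|[O sO]]; last first.
  by have oO := sO.1.1.1; exists (collapse_lospace R oO), (collapse_map R oO); exact: coeq.
exists (constant_fibres q); split.
  split; first exact: clopen_constant_fibres (nC _ (coeq_object cq)).
  exact: const_pt (coeq_eq cq).
move=> O [cO Opt] t qt.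
have [h [hq _]] := coeq_univ cq (Cc O cO.1 cO) (eqc O cO.1 Opt).
apply: contrapT => nOt.
have e s : collapse_fun O (s, t) = h (q (s, t)) by rewrite -[RHS]/((h \o q) (s, t)) hq.
(* As q is constant on the circle over t, the map q_O identifies there the two
   points of angles 0 and pi, although t lies outside O. *)
have c0pi : cis 0 = cis pi :> S1 R.
  by apply: (collapse_fun_out nOt); rewrite !e (qt _ (cis pi)).
have p0 := pi_gt0 R.
suff : (0 : R) = pi by lra.
by apply: cis_inj c0pi; rewrite ltr_norml; apply/andP; split; lra.
Qed.
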